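(* Let $\Phi$ be a random formula with $n$ variables and $m\in\Theta(n)$ clauses drawn from the weighted geometric model on $\mathbb T^d$ equipped with a $\mathfrak p$-norm, with temperature $0<T<1$, with $W\in O(n)$, and with $w_v\in O(n^{1-\varepsilon})$ for every variable $v$ and some constant $\varepsilon>0$. Then with probability $1-O(1/n)$, $\Theta(m)$ clauses of $\Phi$ are nice.
   Context: $\mathbb T^d$ is $[0,1]^d$ with opposite faces identified ($d$ a fixed constant), with distance $\mathrm{dist}(p,q)=\left(\sum_{i=1}^d|p_i-q_i|_\circ^{\mathfrak p}\right)^{1/\mathfrak p}$ (and $\max_i|p_i-q_i|_\circ$ for $\mathfrak p=\infty$), where $|a-b|_\circ=\min\{|a-b|,1-|a-b|\}$ and $\mathfrak p\in\mathbb N^+\cup\{\infty\}$ is fixed. Weighted geometric $k$-SAT model ($k$ constant): $n$ variables with weights $w_v\ge1$, minimum $1$, total $W=\sum_v w_v$, and $m$ clauses; all get independent uniformly random positions in $\mathbb T^d$. Connection weight $X(c,v)=\left(w_v/\mathrm{dist}(c,v)^d\right)^{1/T}$. Each clause draws $k$ variables one after another without repetition, each draw among the remaining variables with probability proportional to $X(c,v)$; signs are chosen among the $2^k$ patterns (details irrelevant here). A clause $c$ is nice if, for each $j\in[k]$, the $j$-th variable drawn for $c$ is the variable with the $j$-th highest connection weight with $c$. *)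

(* Defs.v *)
From HB Require Import structures.
From mathcomp Require Import all_boot all_order all_algebra.
From mathcomp Require Import all_classical all_reals all_analysis.
Set Implicit Arguments. Unset Strict Implicit. Unset Printing Implicit Defensive.
Import Order.TTheory GRing.Theory Num.Theory.
Local Open Scope ring_scope.

Inductive pnorm := PFin of nat | PInf.

Definition pnorm_ok (p : pnorm) : Prop :=
  match p with PFin q => (0 < q)%N | PInf => True end.

Section Model.
Variable R : realType.

(* circular distance on the 1-torus [0,1] with 0 ~ 1 *)
Definition circ (a b : R) : R := Num.min `|a - b| (1 - `|a - b|).

Definition tdist (d : nat) (p : pnorm) (x y : 'I_d -> R) : R :=
  match p with
  | PFin q => (\sum_(i < d) circ (x i) (y i) ^+ q) `^ (q%:R^-1)
  | PInf => \big[Num.max/0]_(i < d) circ (x i) (y i)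
  end.

Definition connw (d : nat) (p : pnorm) (T : R) (wv : R) (c v : 'I_d -> R) : R :=
  (wv / tdist p c v ^+ d) `^ (T^-1).

(* Probability that a clause, whose connection weights to the variables are
   given by X, draws the ordered k-tuple s of variables (drawing one after the
   other without repetition, each draw proportional to X among the remaining). *)
Definition draw_prob (n k : nat) (X : 'I_n -> R) (s : k.-tuple 'I_n) : R :=
  if uniq s then
    \prod_(j < k) (X (tnth s j) /
       \sum_(u < n | u \notin take j s) X u)
  else 0.

Definition nice (n k : nat) (X : 'I_n -> R) (s : k.-tuple 'I_n) : bool :=
  [forall j : 'I_k, forall u : 'I_n,
     (u \notin take j s) ==> (X u <= X (tnth s j))].

(* Iterated integral of F over [0,1]^N, coordinates 0..N-1 of a point
   y : nat -> R (i.e. the expectation of F under the uniform distribution on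
   the cube, all coordinates independent). *)
Fixpoint cube_int (N : nat) (F : (nat -> R) -> \bar R) : \bar R :=
  match N with
  | 0 => F (fun _ => 0)
  | N'.+1 => (\int[@lebesgue_measure R]_(x in `[0%R, 1%R])
               cube_int N' (fun y => F (fun i => if i == N' then x else y i)))%E
  end.

(* Random positions: point number i (variables are 0..n-1, clauses are
   n..n+m-1) has coordinate j stored at y (i*d + j). *)
Definition pos (d : nat) (y : nat -> R) (i : nat) : 'I_d -> R :=
  fun j => y (i * d + j)%N.

(* Probability that, in the weighted geometric k-SAT model with n variables of
   weights w and m clauses, at least a (real) number t of clauses are nice.
   Given the positions, the clauses draw their variables independently;
   signs are irrelevant for this event and are summed out. *)
Definition prob_nice_ge (d k : nat) (p : pnorm) (T : R) (n m : nat)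
    (w : 'I_n -> R) (t : R) : \bar R :=
  cube_int ((n + m) * d) (fun y =>
    let X (c : 'I_m) (v : 'I_n) :=
        connw p T (w v) (@pos d y (n + c)) (@pos d y v) in
    (\sum_(S : {ffun 'I_m -> k.-tuple 'I_n})
        (\prod_(c < m) draw_prob (X c) (S c)) *
        (if t <= (#|[set c : 'I_m | nice (X c) (S c)]|)%:R then 1 else 0))%:E).

End Model.
Arguments prob_nice_ge {R} d k p T n m w t.

(* Main.v *)
(** Write [u_v] for [w_v / dist(c, v)^d] and [al = 1 / T > 1], so that the connection
    weight is [u_v ^ al].  Whatever the positions of the variables, for a uniform clause
    position the volume of [u_v > s] is [O(w_v / s)], and summing the dyadic shells
    [B / 2^(j+1) < u_v <= B / 2^j] with [B = b n] shows that all but a small fraction of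
    the clause positions have total connection weight [O(n ^ al)]: the series converges
    because [al > 1], and [W = O(n)].  Cut the torus into [Theta(n)] cells with many
    variables each on average.  By an exponential moment and a union bound over sets of
    cells, with probability [1 - exp(- Omega(n))] at least half of the cells contain [k]
    variables; a clause in such a cell has [k] connection weights of order [n ^ al].  Hence
    a clause has a constant probability of being nice, conditionally on such variable
    positions; given these the clauses are independent, so Chernoff's method applies. *)
Require Import Defs.
From HB Require Import structures.
From mathcomp Require Import all_boot all_order all_algebra.
From mathcomp Require Import all_classical all_reals all_analysis.
From mathcomp Require Import measurable_realfun ring lra.
Set Implicit Arguments. Unset Strict Implicit. Unset Printing Implicit Defensive.
Import Order.TTheory GRing.Theory Num.Theory.
Import HBNNSimple.
Local Open Scope ring_scope.

(** * The uniform probability on the cube *)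

Section CubeMeasure.
Local Open Scope classical_set_scope.
Variable R : realType.

(** A separate name, so that the sigma-algebra generated by the coordinates can be attached to it.
    Infinite sequences let a single space carry the cubes of all dimensions, as in [cube_int]. *)
Definition Rseq := nat -> R.
HB.instance Definition _ := gen_eqMixin Rseq.
HB.instance Definition _ := gen_choiceMixin Rseq.
HB.instance Definition _ := isPointed.Build Rseq (fun=> 0).

Definition coord_sets : set (set Rseq) :=
  [set A | exists i (B : set R), measurable B /\ A = (fun y : Rseq => y i) @^-1` B].

Definition Om : measurableType _ := g_sigma_algebraType coord_sets.

Lemma measurable_coord i : measurable_fun [set: Om] (fun y : Om => y i).
Proof.
move=> _ B mB; rewrite setTI; apply: sub_sigma_algebra.
by exists i, B.
Qed.

Lemma measurable_to_Om d (T : measurableType d) (f : T -> Om) :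
  (forall i, measurable_fun [set: T] (fun t => f t i)) ->
  measurable_fun [set: T] f.
Proof.
move=> mf; apply: (@measurability _ _ T Om setT f coord_sets) => //.
move=> _ [_ [i [B [mB ->]]] <-].
exact: mf.
Qed.

Definition upd (N : nat) (xy : measurableTypeR R * Om) : Om :=
  fun i => if i == N then xy.1 else xy.2 i.

Lemma measurable_upd N : measurable_fun [set: measurableTypeR R * Om] (upd N).
Proof.
apply: measurable_to_Om => i; rewrite /upd; case: (i == N).
  exact: measurable_fst.
exact: measurableT_comp (measurable_coord i) measurable_snd.
Qed.

HB.instance Definition _ N := isMeasurableFun.Build _ _ _ _ (upd N)
  (measurable_upd N).

Definition unif01 : probability (measurableTypeR R) R := uniform_prob (@ltr01 R).

(** The recursion mirrors [cube_int]: a uniform value overwrites coordinate [N'], while the Dirac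
    mass at the base keeps all later coordinates at 0. *)
Fixpoint cubeP (N : nat) : probability Om R :=
  match N with
  | 0 => \d_((fun _ => 0) : Om)
  | N'.+1 => distribution (unif01 \x cubeP N')%E (upd N')
  end.

Definition in_cube N (y : nat -> R) := forall i, (i < N)%N -> 0 <= y i <= 1.

(** The integral of a nonnegative function, measurable or not, is a supremum over the simple
    functions below it, and this family grows with the function. *)
Lemma ge0_le_integral_nonmeasurable d (T : measurableType d) (mu : {measure set T -> \bar R})
    (D : set T) (f g : T -> \bar R) :
  (forall x, D x -> 0 <= f x)%E -> (forall x, D x -> f x <= g x)%E ->
  (\int[mu]_(x in D) f x <= \int[mu]_(x in D) g x)%E.
Proof.
move=> f0 fg.
have g0 x : D x -> (0 <= g x)%E by move=> Dx; rewrite (le_trans (f0 _ Dx)) ?fg.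
rewrite !ge0_integralE//; apply: ge_ereal_sup => _ [h /= hf <-].
apply: ereal_sup_ubound; exists h => // x.
by rewrite (le_trans (hf x))// lee_restrict.
Qed.

Lemma cube_int_ge0 N (F : (nat -> R) -> \bar R) :
  (forall y, in_cube N y -> 0 <= F y)%E -> (0 <= cube_int N F)%E.
Proof.
elim: N F => [|N IH] F F0 /=; first exact: F0.
apply: integral_ge0 => x /=; rewrite in_itv /= => x01.
apply: IH => y y01; apply: F0 => i; rewrite ltnS leq_eqVlt.
by case: eqP => //= _ /y01.
Qed.

Lemma cube_int_le N (F G : (nat -> R) -> \bar R) :
  (forall y, in_cube N y -> 0 <= F y)%E ->
  (forall y, in_cube N y -> F y <= G y)%E -> (cube_int N F <= cube_int N G)%E.
Proof.
elim: N F G => [|N IH] F G F0 FG /=; first exact: FG.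
have K x y : x \in `[0, 1]%R -> in_cube N y ->
    in_cube N.+1 (fun i => if i == N then x else y i).
  rewrite in_itv /= => x01 y01 i; rewrite ltnS leq_eqVlt.
  by case: eqP => //= _ /y01.
apply: ge0_le_integral_nonmeasurable => x /= x01.
  by apply: cube_int_ge0 => y y01; apply/F0/K.
by apply: IH => y y01; [apply/F0/K|apply/FG/K].
Qed.

(** The iterated integral evaluates its integrand only at sequences that vanish from [N] on. *)
Lemma cube_int_ext N (F G : (nat -> R) -> \bar R) :
  (forall y, (forall i, (N <= i)%N -> y i = 0) -> F y = G y) ->
  cube_int N F = cube_int N G.
Proof.
elim: N F G => [|N IH] F G FG /=; first exact: FG.
apply: eq_integral => x _; apply: IH => y y0; apply: FG => i Ni.
by rewrite gtn_eqF// y0// ltnW.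
Qed.

Lemma cube_intE N (f : Om -> \bar R) :
  measurable_fun [set: Om] f -> (forall y, 0 <= f y)%E ->
  cube_int N f = (\int[cubeP N]_y f y)%E.
Proof.
elim: N f => [|N IH] f mf f0 /=.
  by rewrite integral_dirac// diracT mul1e.
have mfu : measurable_fun [set: measurableTypeR R * Om] (f \o upd N).
  exact: measurableT_comp mf (measurable_upd N).
rewrite ge0_integral_distribution//.
rewrite fubini_tonelli1//=.
have mF := measurable_fun_fubini_tonelli_F (m2 := cubeP N) _ mfu (fun x => f0 _).
rewrite integral_uniform//; last by move=> x; apply: integral_ge0 => y _; exact: f0.
rewrite subr0 invr1 mul1e; apply: eq_integral => x _.
rewrite IH//.
exact: (measurable_fun_pair2 x mfu).
Qed.

Definition splice A (y z : Om) : Om :=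
  fun i => if (i < A)%N then y i else z (i - A)%N.

(** The last coordinate is integrated outermost, so the last [B] integrals peel off in the same
    order on both sides. *)
Lemma cube_int_splice A B (F : Om -> \bar R) :
  cube_int (A + B) F =
  cube_int B (fun z => cube_int A (fun y => F (splice A y z))).
Proof.
elim: B F => [|B IH] F /=.
  rewrite addn0; apply: cube_int_ext => y y0; congr F; apply/funext => i.
  by rewrite /splice; case: ltnP => // /y0.
rewrite addnS /=; apply: eq_integral => x _; rewrite IH.
congr cube_int; apply/funext => z; congr cube_int; apply/funext => y.
congr F; apply/funext => i; rewrite /splice.
case: ltnP => iA; first by rewrite ltn_eqF// ltn_addr.
by rewrite -{1}(subnKC iA) eqn_add2l.
Qed.

Lemma measurable_splice A : measurable_fun [set: Om * Om] (fun p => splice A p.1 p.2).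
Proof.
apply: measurable_to_Om => i; rewrite /splice; case: ltnP => _.
  exact: measurableT_comp (measurable_coord i) measurable_fst.
exact: measurableT_comp (measurable_coord _) measurable_snd.
Qed.

(** Tonelli reverses the order given by [cube_int_splice]: the first block becomes the outer one.
    With the variables in it, this is conditioning on their positions. *)
Lemma cubeP_splice A B (f : Om -> \bar R) :
  measurable_fun [set: Om] f -> (forall y, 0 <= f y)%E ->
  (\int[cubeP (A + B)]_y f y =
   \int[cubeP A]_y \int[cubeP B]_z f (splice A y z))%E.
Proof.
move=> mf f0.
have mfm : measurable_fun [set: Om * Om] (fun p => f (splice A p.1 p.2)).
  exact: measurableT_comp mf (measurable_splice A).
rewrite -cube_intE// cube_int_splice.
rewrite (@fubini_tonelli _ _ Om Om R (cubeP A) (cubeP B) _ mfm)//=.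
have mG := measurable_fun_fubini_tonelli_G (m1 := cubeP A) _ mfm (fun x => f0 _).
rewrite -cube_intE//; last by move=> y; apply: integral_ge0 => z _; exact: f0.
congr cube_int; apply/funext => z; rewrite cube_intE//.
have := measurable_fun_pair1 (z : Om) mfm; exact.
Qed.

End CubeMeasure.

(** * Expectations over the cube *)

Section Expectation.
Local Open Scope classical_set_scope.
Variable R : realType.
Local Notation Om := (Om R).
Implicit Types (f g : Om -> R) (N : nat).

Definition EX N (f : Om -> R) : \bar R := (\int[cubeP R N]_y (f y)%:E)%E.

Lemma EX_cube_int N f : measurable_fun [set: Om] f -> (forall y, 0 <= f y) ->
  EX N f = cube_int N (fun y => (f y)%:E).
Proof.
move=> mf f0; rewrite /EX cube_intE//; exact/measurable_EFinP.
Qed.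

Lemma EX_le N f g : measurable_fun [set: Om] f -> measurable_fun [set: Om] g ->
  (forall y, 0 <= f y) -> (forall y, 0 <= g y) ->
  (forall y, in_cube N y -> f y <= g y) -> (EX N f <= EX N g)%E.
Proof.
move=> mf mg f0 g0 fg; rewrite !EX_cube_int//.
by apply: cube_int_le => y yN; rewrite lee_fin//; exact: fg.
Qed.

Lemma EX_cst N c : EX N (fun=> c) = c%:E.
Proof.
rewrite /EX integral_cst// -[RHS]mule1; congr (_ * _)%E.
exact: probability_setT.
Qed.

Lemma EX_add N f g : measurable_fun [set: Om] f -> measurable_fun [set: Om] g ->
  (forall y, 0 <= f y) -> (forall y, 0 <= g y) ->
  EX N (fun y => f y + g y) = (EX N f + EX N g)%E.
Proof.
move=> mf mg f0 g0; rewrite /EX -ge0_integralD//.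
- by move=> y _; rewrite lee_fin.
- exact/measurable_EFinP.
- by move=> y _; rewrite lee_fin.
- exact/measurable_EFinP.
Qed.

Lemma EX_scale N c f : measurable_fun [set: Om] f -> 0 <= c ->
  (forall y, 0 <= f y) -> EX N (fun y => c * f y) = (c%:E * EX N f)%E.
Proof.
move=> mf c0 f0; rewrite /EX -ge0_integralZl//; first exact/measurable_EFinP.
by move=> y _; rewrite lee_fin.
Qed.

Lemma EX_sum N (I : finType) (P : pred I) (f : I -> Om -> R) :
  (forall i, measurable_fun [set: Om] (f i)) -> (forall i y, 0 <= f i y) ->
  EX N (fun y => \sum_(i | P i) f i y) = (\sum_(i | P i) EX N (f i))%E.
Proof.
move=> mf f0; rewrite /EX.
under eq_integral do rewrite -sumEFin -big_filter.
rewrite -[RHS]big_filter.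
rewrite ge0_integral_sum//; first by move=> i; exact/measurable_EFinP.
by move=> i y _; rewrite lee_fin.
Qed.

(** Stands in for subtracting expectations: [f + g] has expectation 1, and the finite value [e] can
    be cancelled in the extended reals. *)
Lemma EX_compl N f g e : measurable_fun [set: Om] f -> measurable_fun [set: Om] g ->
  (forall y, 0 <= f y) -> (forall y, 0 <= g y) -> (forall y, f y + g y = 1) ->
  EX N g = e%:E -> EX N f = (1 - e)%:E.
Proof.
move=> mf mg f0 g0 fg Eg.
have := EX_add N mf mg f0 g0.
under eq_fun do rewrite fg.
rewrite EX_cst Eg => H.
by rewrite EFinB H addeK.
Qed.

Lemma EX_ge0 N f : (forall y, 0 <= f y) -> (0 <= EX N f)%E.
Proof. by move=> f0; apply: integral_ge0 => y _; rewrite lee_fin. Qed.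

(* [F] itself need not be measurable: the integral of a nonnegative function
   is a supremum over the simple functions below it. *)
Lemma cube_int_ge_compl N (F : Om -> \bar R) (H : Om -> R) e :
  measurable_fun [set: Om] H -> (forall y, 0 <= H y) ->
  (forall y, in_cube N y -> 0 <= F y)%E ->
  (forall y, in_cube N y -> (1 - H y)%:E <= F y)%E ->
  (EX N H <= e%:E)%E -> ((1 - e)%:E <= cube_int N F)%E.
Proof.
move=> mH H0 F0 HF He.
(* The positive part of [1 - H] is measurable, nonnegative and still below [F], and it satisfies
   [1 <= f + H]. *)
pose f y := Num.max 0 (1 - H y).
have mf : measurable_fun [set: Om] f.
  by apply: measurable_maxr => //; apply: measurable_funB.
have f0 y : 0 <= f y by rewrite /f le_max lexx.
have fF : (EX N f <= cube_int N F)%E.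
  rewrite EX_cube_int//; apply: cube_int_le => y yN; first by rewrite lee_fin.
  by rewrite /f; have [_|_] := leP 0 (1 - H y); [exact: (HF y yN)|exact: (F0 y yN)].
apply: le_trans fF.
have : (1 <= EX N f + EX N H)%E.
  rewrite -EX_add// -(EX_cst N); apply: EX_le => //.
  - exact: measurable_funD.
  - by move=> y; rewrite addr_ge0.
  - by move=> y _; rewrite -lerBlDr /f le_max lexx orbT.
move=> h; rewrite EFinB leeBlDr//.
by apply: (le_trans h); apply: leeD2l.
Qed.

Lemma measurable_EX_splice A B f : measurable_fun [set: Om] f ->
  (forall y, 0 <= f y) ->
  measurable_fun [set: Om] (fun y => EX B (fun z => f (splice A y z))).
Proof.
move=> mf f0.
have mfm : measurable_fun [set: Om * Om] (fun p => (f (splice A p.1 p.2))%:E).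
  by apply/measurable_EFinP; exact: measurableT_comp mf (@measurable_splice R A).
apply: (measurable_fun_fubini_tonelli_F (m2 := cubeP R B) _ mfm).
by move=> p; rewrite lee_fin.
Qed.

Lemma EX_splice A B f : measurable_fun [set: Om] f -> (forall y, 0 <= f y) ->
  EX (A + B) f = (\int[cubeP R A]_y EX B (fun z => f (splice A y z)))%E.
Proof.
move=> mf f0; rewrite /EX cubeP_splice//; exact/measurable_EFinP.
Qed.

(** A conditional bound that is uniform in the first block survives averaging over it. The passage
    through [cube_int] allows the bound to be assumed only inside the cube. *)
Lemma EX_splice_le A B f e : measurable_fun [set: Om] f -> (forall y, 0 <= f y) ->
  (forall y, in_cube A y -> (EX B (fun z => f (splice A y z)) <= e%:E)%E) ->
  (EX (A + B) f <= e%:E)%E.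
Proof.
move=> mf f0 H; rewrite EX_splice// -cube_intE; last 2 first.
- exact: measurable_EX_splice.
- by move=> y; apply: EX_ge0 => z; exact: f0.
rewrite -(EX_cst A e) /EX -cube_intE; last 2 first.
- exact: measurable_cst.
(* The origin lies in the cube, so the assumed bound at this point yields [0 <= e]. *)
- move=> y; have : in_cube A (fun=> 0 : R) by move=> i _; rewrite lexx ler01.
  by move/H; apply: le_trans; apply: EX_ge0 => z; exact: f0.
by apply: cube_int_le => y yA; [apply: EX_ge0 => z; exact: f0|exact: H].
Qed.

Lemma EX_splice_fst A B f g : measurable_fun [set: Om] f -> (forall y, 0 <= f y) ->
  (forall y z, f (splice A y z) = g y) -> EX (A + B) f = EX A g.
Proof.
move=> mf f0 fg; rewrite EX_splice//; apply: eq_integral => y _.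
by under eq_fun do rewrite fg; rewrite EX_cst.
Qed.

Lemma measurable_pos_comp d (h : ('I_d -> R) -> R) i :
  measurable_fun [set: Om] (fun y : Om => h (@pos R d y 0)) ->
  measurable_fun [set: Om] (fun y : Om => h (@pos R d y i)).
Proof.
move=> mh.
have ms : measurable_fun [set: Om] (fun y : Om => (fun j => y (i * d + j)%N) : Om).
  by apply: measurable_to_Om => j; exact: measurable_coord.
exact: (measurableT_comp mh ms).
Qed.

(** Independence of the points: each occupies its own block of [d] coordinates. The induction splits
    off the first block and shifts the remaining ones. *)
Lemma EX_blocks_le d m (h : nat -> ('I_d -> R) -> R) (e : nat -> R) :
  (forall i, measurable_fun [set: Om] (fun y : Om => h i (@pos R d y 0))) ->
  (forall i x, 0 <= h i x) ->
  (forall i, (EX d (fun y => h i (@pos R d y 0)) <= (e i)%:E)%E) ->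
  (EX (m * d) (fun y => (\prod_(i < m) h i (@pos R d y i))%R) <=
    (\prod_(i < m) e i)%R%:E)%E.
Proof.
elim: m h e => [|m IH] h e mh h0 he.
  by under eq_fun do rewrite big_ord0; rewrite big_ord0 EX_cst.
have e0 i : 0 <= e i.
  by rewrite -lee_fin; apply: le_trans (he i); apply: EX_ge0.
have mP (k : nat) (hh : nat -> ('I_d -> R) -> R) :
    (forall i, measurable_fun [set: Om] (fun y : Om => hh i (@pos R d y 0))) ->
    measurable_fun [set: Om] (fun y : Om => \prod_(i < k) hh i (@pos R d y i)).
  move=> mhh; apply: measurable_prod => i _.
  exact: (measurable_pos_comp (h := hh i)).
rewrite mulSn EX_splice//; last by move=> y; apply: prodr_ge0.
  2: exact: mP.
rewrite big_ord_recl.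
apply: (@le_trans _ _ (\int[cubeP R d]_y ((h 0%N (@pos R d y 0))%:E *
    (\prod_(i < m) e i.+1)%:E))%E).
  apply: ge0_le_integral_nonmeasurable => y _.
    by apply: EX_ge0 => z; apply: prodr_ge0.
  under eq_fun => z.
    rewrite big_ord_recl.
    have -> : @pos R d (splice d y z) (@ord0 m) = @pos R d y 0.
      by apply/funext => j; rewrite /pos /splice /= mul0n add0n ltn_ord.
    under eq_bigr => i _.
      have -> : @pos R d (splice d y z) (lift ord0 i) = @pos R d z i.
        apply/funext => j; rewrite /pos /splice /= /bump /= add1n mulSn -addnA.
        by rewrite ltnNge leq_addr /= addKn.
      over.
    over.
  rewrite EX_scale//; last 2 first.
  - exact: (mP m (fun i => h i.+1)).
  - by move=> z; apply: prodr_ge0.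
  rewrite lee_wpmul2l ?lee_fin//.
  by apply: (IH (fun i => h i.+1) (fun i => e i.+1)) => // i.
rewrite ge0_integralZr//.
- by rewrite EFinM lee_wpmul2r ?he ?lee_fin ?prodr_ge0// => i _; exact: e0.
- exact/measurable_EFinP.
- by move=> y _; rewrite lee_fin.
- by rewrite lee_fin prodr_ge0// => i _; exact: e0.
Qed.

Lemma EX_coords d (g : nat -> R -> R) (e : nat -> R) :
  (forall j, measurable_fun [set: R] (g j)) -> (forall j x, 0 <= g j x) ->
  (forall j, (\int[@lebesgue_measure R]_(x in `[0%R, 1%R]) (g j x)%:E = (e j)%:E)%E) ->
  EX d (fun y => \prod_(j < d) g j (y j)) = (\prod_(j < d) e j)%:E.
Proof.
move=> mg g0 ge.
have mP k : measurable_fun [set: Om] (fun y : Om => \prod_(j < k) g j (y j)).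
  apply: measurable_prod => j _.
  exact: (measurableT_comp (mg j) (@measurable_coord R j)).
elim: d => [|d IH].
  by under eq_fun do rewrite big_ord0; rewrite big_ord0 EX_cst.
rewrite EX_cube_int//; last by move=> y; apply: prodr_ge0.
rewrite /= big_ord_recr /=.
transitivity (\int[@lebesgue_measure R]_(x in `[0%R, 1%R])
    ((\prod_(i < d) e i)%:E * (g d x)%:E))%E.
  apply: eq_integral => x _; rewrite muleC.
  rewrite -IH -EX_scale//; last by move=> y; apply: prodr_ge0.
  rewrite EX_cube_int//; last 2 first.
  - exact: measurable_funM.
  - by move=> y; rewrite mulr_ge0// prodr_ge0.
  congr cube_int; apply/funext => y; rewrite big_ord_recr /= eqxx mulrC.
  congr (_ * _)%:E; apply: eq_bigr => i _.
  by rewrite ltn_eqF.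
rewrite ge0_integralZl//.
- by rewrite ge EFinM.
- by apply/measurable_EFinP; apply: measurable_funS (mg d).
- by move=> x _; rewrite lee_fin.
- rewrite lee_fin prodr_ge0// => i _; rewrite -lee_fin -ge.
  by apply: integral_ge0 => x _; rewrite lee_fin.
Qed.

End Expectation.

(** * Volumes of balls and cells *)

Section Measurability.
Local Open Scope classical_set_scope.
Variable R : realType.
Context {dT : measure_display} {T : measurableType dT}.

Lemma measurable_natr_bool (b : T -> bool) : measurable_fun [set: T] b ->
  measurable_fun [set: T] (fun t => (b t)%:R : R).
Proof.
move=> mb.
have -> : (fun t => (b t)%:R : R) = (fun t => if b t then 1 else 0).
  by apply/funext => t; case: (b t).
exact: measurable_fun_ifT.
Qed.

Lemma measurable_forall (I : finType) (b : I -> T -> bool) :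
  (forall i, measurable_fun [set: T] (b i)) ->
  measurable_fun [set: T] (fun t => [forall i, b i t]).
Proof.
move=> mb.
have -> : (fun t => [forall i, b i t]) = (fun t => all (b^~ t) (enum I)).
  apply/funext => t; apply/forallP/allP => [H i _|H i]; first exact: H.
  by apply: H; rewrite mem_enum.
elim: (enum I) => [|i s IH] /=; first exact: measurable_cst.
exact: measurable_and.
Qed.

Lemma measurable_exists (I : finType) (b : I -> T -> bool) :
  (forall i, measurable_fun [set: T] (b i)) ->
  measurable_fun [set: T] (fun t => [exists i, b i t]).
Proof.
move=> mb.
have -> : (fun t => [exists i, b i t]) = (fun t => ~~ [forall i, ~~ b i t]).
  by apply/funext => t; rewrite negb_forall; apply: eq_existsb => i; rewrite negbK.
by apply/measurable_neg/measurable_forall => i; exact: measurable_neg.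
Qed.

Lemma measurable_sum_fin (I : finType) (P : pred I) (f : I -> T -> R) :
  (forall i, measurable_fun [set: T] (f i)) ->
  measurable_fun [set: T] (fun t => \sum_(i | P i) f i t).
Proof.
move=> mf.
have -> : (fun t => \sum_(i | P i) f i t) =
          (fun t => \sum_(i <- [seq i <- enum I | P i]) f i t).
  by apply/funext => t; rewrite big_filter big_enum_cond.
exact: measurable_sum.
Qed.

Lemma measurable_circ (f g : T -> R) :
  measurable_fun [set: T] f -> measurable_fun [set: T] g ->
  measurable_fun [set: T] (fun t => circ (f t) (g t)).
Proof.
move=> mf mg; rewrite /circ.
have mn : measurable_fun [set: T] (fun t => `|f t - g t|).
  by apply: measurableT_comp => //; exact: measurable_funB.
by apply: measurable_minr => //; apply: measurable_funB.
Qed.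

End Measurability.

Lemma natr_forall (R : comPzRingType) (I : finType) (b : I -> bool) :
  ([forall i, b i])%:R = \prod_i (b i)%:R :> R.
Proof.
have [/forallP H|] := boolP [forall i, b i].
  by rewrite big1// => i _; rewrite H.
rewrite negb_forall => /existsP[i /negbTE bi].
by rewrite (bigD1 i)//= bi mul0r.
Qed.

Section Geometry.
Local Open Scope classical_set_scope.
Variable R : realType.
Local Notation Om := (Om R).

(** The ball of the max-norm, whatever [p] is: its indicator is a product over the coordinates, and
    the change of norm costs only constants. *)
Definition near_pt d (r : R) (x y : 'I_d -> R) : bool :=
  [forall i, circ (x i) (y i) < r].

(** Half-open boxes make the cells disjoint; points with a coordinate equal to 1 lie in no cell. *)
Definition in_cell d L (e : {ffun 'I_d -> 'I_L}) (x : 'I_d -> R) : bool :=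
  [forall i, ((e i)%:R / L%:R <= x i) && (x i < (e i).+1%:R / L%:R)].

Definition in_unit d (x : 'I_d -> R) := forall i, 0 <= x i <= 1.

Section Meas.
Context {dT : measure_display} {T : measurableType dT}.

Lemma measurable_near_pt d r (x y : T -> 'I_d -> R) :
  (forall i, measurable_fun [set: T] (x^~ i)) ->
  (forall i, measurable_fun [set: T] (y^~ i)) ->
  measurable_fun [set: T] (fun t => near_pt r (x t) (y t)).
Proof.
move=> mx my; apply: measurable_forall => i.
by apply: measurable_fun_ltr => //; exact: measurable_circ.
Qed.

Lemma measurable_in_cell d L (e : {ffun 'I_d -> 'I_L}) (x : T -> 'I_d -> R) :
  (forall i, measurable_fun [set: T] (x^~ i)) ->
  measurable_fun [set: T] (fun t => in_cell e (x t)).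
Proof.
move=> mx; apply: measurable_forall => i; apply: measurable_and.
  by apply: measurable_fun_ler => //; exact: measurable_cst.
by apply: measurable_fun_ltr => //; exact: measurable_cst.
Qed.

End Meas.

Lemma EX_coords_ord d (g : 'I_d -> R -> R) (e : 'I_d -> R) : (0 < d)%N ->
  (forall j, measurable_fun [set: R] (g j)) -> (forall j x, 0 <= g j x) ->
  (forall j, (\int[@lebesgue_measure R]_(x in `[0%R, 1%R]) (g j x)%:E = (e j)%:E)%E) ->
  EX d (fun y => \prod_(j < d) g j (y j)) = (\prod_(j < d) e j)%:E.
Proof.
case: d g e => // d g e _ mg g0 ge.
have := @EX_coords R d.+1 (fun j => g (inord j)) (fun j => e (inord j))
  (fun j => mg _) (fun j => g0 _) (fun j => ge _).
under eq_fun do under eq_bigr do rewrite inord_val.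
by under [in RHS]eq_bigr do rewrite inord_val.
Qed.

Lemma integral01_bool (b : R -> bool) : measurable_fun [set: R] b ->
  (\int[@lebesgue_measure R]_(x in `[0%R, 1%R]) ((b x)%:R)%:E =
   lebesgue_measure ([set x | b x] `&` `[0%R, 1%R]))%E.
Proof.
move=> mb; rewrite -integral_indic//.
  apply: eq_integral => x _; rewrite indicE.
  suff -> : (x \in [set x | b x]) = b x by [].
  by apply/idP/idP; rewrite inE.
by have := mb measurableT [set true] I; rewrite setTI.
Qed.

(** On the line the arc around [b] is covered by three intervals of length [2 * r], centred at [b],
    [b + 1] and [b - 1]. *)
Lemma circ_lt_measure (b r : R) : 0 <= b <= 1 -> 0 <= r ->
  (lebesgue_measure ([set x | (circ x b < r)%R] `&` `[0%R, 1%R]%classic) <=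
   (6 * r)%:E)%E.
Proof.
move=> /andP[b0 b1] r0.
have sub : [set x | circ x b < r] `&` `[0, 1]%classic `<=`
    `]b - r, b + r[%classic `|` `]b + 1 - r, b + 1 + r[%classic
    `|` `]b - 1 - r, b - 1 + r[%classic.
  move=> x [/=]; rewrite /circ !in_itv /= gt_min => /orP[H|H] /andP[x0 x1].
    by left; left; move: H; rewrite ltr_distlC => /andP[? ?]; apply/andP; split; lra.
  have [xb|xb] := leP b x.
    left; right; move: H; rewrite ger0_norm ?subr_ge0// => H.
    by apply/andP; split; lra.
  right; move: H; rewrite ltr0_norm ?subr_lt0// => H.
  by apply/andP; split; lra.
have l2 (c : R) : lebesgue_measure `]c - r, c + r[%classic = (2 * r)%:E :> \bar R.
  rewrite lebesgue_measure_itv /= lte_fin.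
  have -> : ((c + r)%R%:E - (c - r)%R%:E)%E = (2 * r)%:E :> \bar R.
    by rewrite -EFinB; congr EFin; lra.
  by case: ltP => // H; congr EFin; lra.
have mcirc : measurable ([set x | circ x b < r] : set R).
  have := @measurable_fun_ltr _ R R setT _ _
    (@measurable_circ R _ R id (fun=> b) (@measurable_id _ _ _) (@measurable_cst _ _ _ _ _ _))
    (@measurable_cst _ _ _ _ _ r).
  by move=> /(_ measurableT [set true] I); rewrite setTI.
apply: (@le_trans _ _ (lebesgue_measure (`]b - r, b + r[%classic `|`
    `]b + 1 - r, b + 1 + r[%classic `|` `]b - 1 - r, b - 1 + r[%classic))).
  apply: le_measure => //; rewrite inE; first exact: measurableI.
  by do 2 apply: measurableU => //.
apply: (le_trans (measureU2 _ _ _)) => //; first exact: measurableU.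
have -> : 6 * r = 2 * r + 2 * r + 2 * r by lra.
have l2_le (c : R) : (lebesgue_measure `](c - r)%R, (c + r)%R[%classic <= (2 * r)%:E)%E.
  by rewrite l2.
rewrite !EFinD; apply: leeD; last exact: l2_le.
by apply: (le_trans (measureU2 _ _ _)) => //; apply: leeD; exact: l2_le.
Qed.

Lemma EX_near_pt_le d (r : R) (v : 'I_d -> R) : (0 < d)%N -> in_unit v -> 0 <= r ->
  (EX d (fun y => (near_pt r (@pos R d y 0) v)%:R) <= ((6 * r) ^+ d)%:E)%E.
Proof.
move=> d0 v01 r0.
pose S j := [set x | circ x (v j) < r] `&` `[0, 1]%classic.
have Sfin j : (lebesgue_measure (S j) \is a fin_num)%E.
  rewrite ge0_fin_numE//; apply: le_lt_trans (ltry (6 * r)).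
  exact: circ_lt_measure.
have mg j : measurable_fun [set: R] (fun x : R => circ x (v j) < r).
  by apply: measurable_fun_ltr => //; apply: measurable_circ.
have -> : EX d (fun y => (near_pt r (@pos R d y 0) v)%:R) =
    EX d (fun y => \prod_(j < d) (circ (y j) (v j) < r)%R%:R).
  by congr EX; apply/funext => y; rewrite natr_forall.
rewrite (@EX_coords_ord _ (fun j x => (circ x (v j) < r)%R%:R)
  (fun j => fine (lebesgue_measure (S j))))//.
- rewrite lee_fin -[X in _ ^+ X]card_ord -prodr_const; apply: ler_prod => j _.
  rewrite fine_ge0//= -lee_fin fineK//; exact: circ_lt_measure.
- by move=> j; exact: measurable_natr_bool.
- by move=> j; rewrite fineK// integral01_bool.
Qed.

Lemma EX_in_cell d L (e : {ffun 'I_d -> 'I_L}) : (0 < d)%N -> (0 < L)%N ->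
  EX d (fun y => (in_cell e (@pos R d y 0))%:R) = ((L%:R ^- d)%:E : \bar R).
Proof.
move=> d0 L0.
have L0' : 0 < L%:R :> R by rewrite ltr0n.
have -> : EX d (fun y => (in_cell e (@pos R d y 0))%:R) =
    EX d (fun y => \prod_(j < d)
      (((e j)%:R / L%:R <= y j) && (y j < (e j).+1%:R / L%:R))%R%:R).
  by congr EX; apply/funext => y; rewrite natr_forall.
rewrite (@EX_coords_ord _ (fun j x => (((e j)%:R / L%:R <= x) &&
  (x < (e j).+1%:R / L%:R))%R%:R) (fun=> L%:R^-1))//.
- by rewrite prodr_const card_ord exprVn.
- move=> j; apply: measurable_natr_bool; apply: measurable_and.
    by apply: measurable_fun_ler.
  by apply: measurable_fun_ltr.
- move=> j; rewrite integral01_bool; last first.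
    by apply: measurable_and; [apply: measurable_fun_ler|apply: measurable_fun_ltr].
  have -> : [set x | ((e j)%:R / L%:R <= x) && (x < (e j).+1%:R / L%:R)] `&`
      `[0, 1]%classic = `[(e j)%:R / L%:R, (e j).+1%:R / L%:R[%classic :> set R.
    apply/seteqP; split => x /=; rewrite !in_itv /=; first by case.
    move=> /andP[h1 h2]; rewrite h1 h2; split=> //; apply/andP; split.
      by apply: le_trans h1; rewrite divr_ge0// ltW.
    apply/ltW/(lt_le_trans h2); rewrite ler_pdivrMr// mul1r ler_nat.
    exact: ltn_ord.
  rewrite lebesgue_measure_itv /= lte_fin ltr_pM2r ?invr_gt0// ltr_nat ltnSn.
  by rewrite -EFinB -mulrBl -natrB// subSnn mul1r.
Qed.

Lemma in_cell_inj d L (e e' : {ffun 'I_d -> 'I_L}) (x : 'I_d -> R) :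
  (0 < L)%N -> in_cell e x -> in_cell e' x -> e = e'.
Proof.
move=> L0 /forallP he /forallP he'; apply/ffunP => i; apply/val_inj/eqP => /=.
have L0' : 0 < L%:R :> R by rewrite ltr0n.
have /andP[a b] := he i; have /andP[a' b'] := he' i.
have := le_lt_trans a b'; have := le_lt_trans a' b.
by rewrite !ltr_pM2r ?invr_gt0// !ltr_nat !ltnS eqn_leq => -> ->.
Qed.

(** Cells are disjoint, so at most one summand is nonzero. *)
Lemma sum_in_cell d L (P : pred {ffun 'I_d -> 'I_L}) (x : 'I_d -> R) : (0 < L)%N ->
  \sum_(e | P e) (in_cell e x)%:R = ([exists e, P e && in_cell e x])%:R :> R.
Proof.
move=> L0; have [/existsP[e /andP[Pe ex]]|] := boolP [exists e, P e && in_cell e x].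
  rewrite (bigD1 e)//= ex big1 ?addr0// => e' /andP[_ /eqP e'e].
  by case: (boolP (in_cell e' x)) => // e'x; case: e'e; exact: in_cell_inj e'x ex.
rewrite negb_exists => /forallP H; rewrite big1// => e Pe.
by have := H e; rewrite Pe /= => /negbTE ->.
Qed.

End Geometry.

(** * Drawing without repetition *)

Section Draws.
Variables (R : realType) (n : nat) (X : 'I_n -> R).

(* Excluding a set [E] of variables makes the normalisation inductive in [k]. *)
Definition draw_prob_excl k (E : seq 'I_n) (s : k.-tuple 'I_n) : R :=
  if uniq s && all (fun u => u \notin E) s then
    \prod_(j < k) (X (tnth s j) /
      \sum_(u < n | (u \notin E) && (u \notin take j s)) X u)
  else 0.

Lemma draw_prob_excl_nil k (s : k.-tuple 'I_n) :
  draw_prob_excl [::] s = draw_prob X s.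
Proof.
rewrite /draw_prob_excl /draw_prob; have -> : all (fun u => u \notin [::]) s by exact/allP.
by rewrite andbT.
Qed.

(** After the first draw the process is of the same kind, with the drawn variable added to the
    excluded ones. *)
Lemma draw_prob_excl_cons k E u (s : k.-tuple 'I_n) :
  draw_prob_excl E [tuple of u :: s] =
  (if u \notin E then X u / \sum_(v < n | v \notin E) X v else 0) *
  draw_prob_excl (u :: E) s.
Proof.
rewrite /draw_prob_excl /=.
have -> : all (fun v => v \notin u :: E) (val s) =
    (u \notin (val s)) && all (fun v => v \notin E) (val s).
  elim: (val s) => //= v t ->; rewrite !inE !negb_or (eq_sym v u).
  by case: (u == v); case: (v \in E); case: (u \in t).
case: (boolP (u \in E)) => uE /=; first by rewrite andbF mul0r.
case: (boolP (u \in s)) => us /=; first by rewrite andbF mulr0.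
case: ifP => _; last by rewrite mulr0.
rewrite big_ord_recl /= tnth0; congr (_ / _ * _).
  by apply: eq_bigl => v; rewrite andbT.
apply: eq_bigr => j _; rewrite tnthS; congr (_ / _).
apply: eq_bigl => v; rewrite !inE !negb_or.
by case: (v == u); case: (v \in E).
Qed.

Lemma draw_prob_ge0 k (s : k.-tuple 'I_n) :
  (forall u, 0 <= X u) -> 0 <= draw_prob X s.
Proof.
move=> X0; rewrite /draw_prob; case: ifP => // _; apply: prodr_ge0 => j _.
by rewrite divr_ge0 ?sumr_ge0.
Qed.

Hypothesis X_gt0 : forall u, 0 < X u.

(** Summing over the tail first, the tail probabilities add up to 1 by induction. Since [E] misses
    some variable and weights are positive, the normaliser of the first draw is positive. *)
Lemma sum_draw_prob_excl k (E : seq 'I_n) : uniq E -> (size E + k <= n)%N ->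
  \sum_(s : k.-tuple 'I_n) draw_prob_excl E s = 1.
Proof.
elim: k E => [|k IH] E uE sE.
  rewrite (bigD1 [tuple])//= big1 ?addr0; last first.
    by move=> s /eqP []; rewrite tuple0.
  by rewrite /draw_prob_excl /= big_ord0.
have SE : 0 < \sum_(v < n | v \notin E) X v.
  have [v vE] : exists v, v \notin E.
    apply/existsP; rewrite -negb_forall; apply/negP => /forallP H.
    have : (#|'I_n| <= size E)%N.
      rewrite cardE; apply: uniq_leq_size; first exact: enum_uniq.
      by move=> v _; exact: H.
    rewrite card_ord => h; have := leq_trans sE h.
    by rewrite addnS ltnNge leq_addr.
  rewrite (bigD1 v)//= ltr_wpDr//; apply: sumr_ge0 => u _; exact: ltW.
pose f (p : 'I_n * k.-tuple 'I_n) : k.+1.-tuple 'I_n := [tuple of p.1 :: p.2].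
pose g (t : k.+1.-tuple 'I_n) := (thead t, [tuple of behead t]).
rewrite (reindex f) /=; last first.
  exists g => [[u s] _|t _]; rewrite /f /g /=.
    by congr pair; apply/val_inj.
  by rewrite [RHS]tuple_eta.
rewrite -(pair_big xpredT xpredT (fun u (s : k.-tuple _) => draw_prob_excl E [tuple of u :: s])) /=.
transitivity (\sum_(u < n | u \notin E) X u / \sum_(v < n | v \notin E) X v).
  rewrite [RHS]big_mkcond; apply: eq_bigr => u _.
  under eq_bigr do rewrite draw_prob_excl_cons.
  rewrite -mulr_sumr; case: (boolP (u \in E)) => uE' /=; first by rewrite mul0r.
  by rewrite IH ?mulr1//= ?uE' ?uE// addSn -addnS.
by rewrite -mulr_suml divff// gt_eqF.
Qed.

Lemma sum_draw_prob k : (k <= n)%N -> \sum_(s : k.-tuple 'I_n) draw_prob X s = 1.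
Proof.
move=> kn; rewrite -(@sum_draw_prob_excl k [::])//.
by apply: eq_bigr => s _; rewrite draw_prob_excl_nil.
Qed.

(* The tuple of the [k] heaviest variables in decreasing order is nice, and
   each of its draws has probability at least [x / S]. *)
Lemma prob_nice_lower k (x S : R) : 0 < x -> \sum_u X u <= S ->
  (k <= #|[set u | (x <= X u)%R]|)%N ->
  (x / S) ^+ k <= \sum_(s : k.-tuple 'I_n | nice X s) draw_prob X s.
Proof.
move=> x0 XS kx.
pose ge u v := X v <= X u.
pose s0 := sort ge (enum 'I_n).
have s0_size : size s0 = n by rewrite size_sort size_enum_ord.
have kn : (k <= n)%N.
  by apply: leq_trans kx _; apply: leq_trans (max_card _) _; rewrite card_ord.
have ge_tr : transitive ge by move=> u v w uv vw; exact: le_trans vw uv.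
have s0_sorted : sorted ge s0.
  by apply: sort_sorted => u v; rewrite /ge le_total.
have s0_uniq : uniq s0 by rewrite sort_uniq enum_uniq.
have s0_mem u : u \in s0 by rewrite mem_sort mem_enum.
have sz : size (take k s0) == k by rewrite size_takel// s0_size.
pose s : k.-tuple 'I_n := Tuple sz.
have nth_s (j : 'I_k) u0 : tnth s j = nth u0 s0 j.
  by rewrite (tnth_nth u0) /= nth_take.
have max_s (j : 'I_k) u : u \notin take j s -> X u <= X (tnth s j).
  rewrite /= take_takel ?(ltnW (ltn_ord j))// => uj.
  have ui : (index u s0 < size s0)%N by rewrite index_mem.
  have ji : (j <= index u s0)%N.
    by rewrite leqNgt; apply: contra uj => h; rewrite in_take.
  rewrite (nth_s j u) -{1}(nth_index u (s0_mem u)).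
  apply: (sorted_leq_nth ge_tr (fun v => lexx _) u s0_sorted) => //.
  by rewrite inE s0_size (leq_trans (ltn_ord j)).
have nice_s : nice X s.
  by apply/forallP => j; apply/forallP => u; apply/implyP; exact: max_s.
(* Before draw [j] only [j < k] variables are used up, so one of the at least [k] variables of
   weight [x] or more remains, and the drawn variable is at least as heavy. *)
have x_le (j : 'I_k) : x <= X (tnth s j).
  have [u /andP[xu uj]] : exists u, (x <= X u) && (u \notin take j s).
    case: (pickP (fun u => (x <= X u) && (u \notin take j s))) => [u hu|H].
      by exists u.
    exfalso.
    have : (#|[set u | (x <= X u)%R]| <= size (take j s))%N.
      rewrite cardE; apply: uniq_leq_size; first exact: enum_uniq.
      move=> u; rewrite mem_enum inE => xu.
      by have := H u; rewrite xu /= => /negbFE.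
    rewrite leqNgt size_take size_tuple ltn_ord => /negP; apply.
    exact: leq_trans (ltn_ord j) kx.
  by apply: le_trans xu _; exact: max_s.
rewrite (bigD1 s)//=; apply: ler_wpDr.
  by apply: sumr_ge0 => t _; apply: draw_prob_ge0 => u; exact: ltW.
rewrite /draw_prob take_uniq//=.
rewrite -[X in _ ^+ X]card_ord -prodr_const; apply: ler_prod => j _.
have Sj0 : 0 < \sum_(u < n | u \notin take j (take k s0)) X u.
  rewrite (bigD1 (tnth s j)) /=; last first.
    rewrite take_takel ?(ltnW (ltn_ord j))// (nth_s j (tnth s j)) in_take ?s0_mem//.
    rewrite index_uniq ?ltnn// s0_size; exact: leq_trans (ltn_ord j) kn.
  by rewrite ltr_wpDr// sumr_ge0// => u _; exact: ltW.
have SjS : \sum_(u < n | u \notin take j (take k s0)) X u <= S.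
  apply: le_trans XS; rewrite [X in _ <= X](bigID (fun u => u \notin take j (take k s0))) /=.
  by rewrite lerDl sumr_ge0// => u _; exact: ltW.
have S0 := lt_le_trans Sj0 SjS.
apply/andP; split; first by rewrite divr_ge0// ltW.
apply: ler_pM => //.
- exact: ltW.
- by rewrite invr_ge0 ltW.
- by rewrite lef_pV2.
Qed.

End Draws.

(* Chernoff's method: the indicator of [N < t] is at most [expR t * (1/2) ^+ N],
   whose expectation factorises over the independent clauses. *)
Lemma chernoff_lower (R : realType) (I S : finType) (D : I -> S -> R)
    (N : I -> S -> bool) (good : I -> bool) (gam t : R) :
  (forall c s, 0 <= D c s) -> (forall c, \sum_s D c s = 1) ->
  (forall c, good c -> gam <= \sum_(s | N c s) D c s) ->
  1 - expR t * \prod_c (1 - gam / 2 * (good c)%:R) <=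
  \sum_(f : {ffun I -> S}) (\prod_c D c (f c)) *
    (if t <= (#|[set c | N c (f c)]|)%:R then 1 else 0).
Proof.
move=> D0 D1 Dgam.
pose Q c s := D c s * (2^-1) ^+ (N c s).
have Q0 c s : 0 <= Q c s by rewrite mulr_ge0// exprn_ge0// invr_ge0.
have QE : \prod_c \sum_s Q c s =
    \sum_(f : {ffun I -> S}) (\prod_c D c (f c)) * (2^-1) ^+ #|[set c | N c (f c)]|.
  rewrite bigA_distr_bigA /=; apply: eq_bigr => f _.
  rewrite big_split /= -expr_sum; congr (_ * _ ^+ _).
  by rewrite -sum1dep_card [RHS]big_mkcond /=; apply: eq_bigr => c _; case: (N _ _).
have Qle : \prod_c \sum_s Q c s <= \prod_c (1 - gam / 2 * (good c)%:R).
  apply: ler_prod => c _; rewrite sumr_ge0//=.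
  (* Halving the mass of the nice outcomes removes half of the probability of being nice. *)
  have -> : \sum_s Q c s = 1 - 2^-1 * \sum_(s | N c s) D c s.
    transitivity (\sum_s D c s - 2^-1 * \sum_(s | N c s) D c s); last by rewrite D1.
    rewrite mulr_sumr [X in _ - X]big_mkcond -sumrB /=.
    by apply: eq_bigr => s _; rewrite /Q; case: (N c s); rewrite /= ?expr1 ?expr0; lra.
  have NN : 0 <= \sum_(s | N c s) D c s by rewrite sumr_ge0.
  case: (boolP (good c)) => gc /=; last by lra.
  by have := Dgam c gc; lra.
have D1' : \sum_(f : {ffun I -> S}) \prod_c D c (f c) = 1.
  by rewrite -(bigA_distr_bigA D) /= big1.
apply: (@le_trans _ _ (1 - expR t * \prod_c \sum_s Q c s)).
  by rewrite lerB// ler_pM2l ?expR_gt0.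
rewrite QE mulr_sumr -[X in X - _]D1' -sumrB; apply: ler_sum => f _.
set P := \prod_c _; set k := #|_|.
have P0 : 0 <= P by rewrite prodr_ge0.
have h0 : 0 <= expR t * (P * 2^-1 ^+ k).
  by rewrite !mulr_ge0// ?expR_ge0// exprn_ge0// invr_ge0.
have [tk|tk] := leP t k%:R; first by rewrite mulr1 gerBl.
rewrite mulr0 subr_le0 mulrCA ler_peMr//.
(* Here [k < t], so the compensating factor is at least [(e / 2) ^ k], and [e >= 2]. *)
apply: (@le_trans _ _ (expR k%:R * 2^-1 ^+ k)); last first.
  by rewrite ler_wpM2r ?exprn_ge0 ?invr_ge0// ler_expR ltW.
rewrite -[k%:R]mul1r expRM_natr -exprMn exprn_ege1//.
by have := @expR_ge1Dx R 1; lra.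
Qed.

(** * Distances and connection weights *)

Section Distance.
Variables (R : realType) (d : nat) (p : pnorm).
Implicit Types x y : 'I_d -> R.

Lemma circ_ge0 (a b : R) : 0 <= a <= 1 -> 0 <= b <= 1 -> 0 <= circ a b.
Proof.
move=> /andP[a0 a1] /andP[b0 b1]; rewrite /circ le_min normr_ge0 /= subr_ge0.
by rewrite ler_norml; apply/andP; split; lra.
Qed.

Lemma exprn_powR_inv (a : R) q : (0 < q)%N -> 0 <= a -> (a ^+ q) `^ (q%:R^-1) = a.
Proof.
move=> q0 a0; rewrite -powR_mulrn// -powRrM mulfV ?powRr1//.
by rewrite pnatr_eq0 -lt0n.
Qed.

Hypothesis p_ok : pnorm_ok p.

Lemma circ_le_tdist x y i : in_unit x -> in_unit y -> circ (x i) (y i) <= tdist p x y.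
Proof.
move=> x01 y01; have c0 j : 0 <= circ (x j) (y j) by exact: circ_ge0.
case: p p_ok => [q|] /= ok; last by exact: (le_bigmax _ (fun i => circ (x i) (y i))).
rewrite -{1}(exprn_powR_inv ok (c0 i)); apply: ge0_ler_powR.
- by rewrite invr_ge0.
- by rewrite nnegrE exprn_ge0.
- by rewrite nnegrE sumr_ge0// => j _; rewrite exprn_ge0.
- by rewrite (bigD1 i)//= lerDl sumr_ge0// => j _; rewrite exprn_ge0.
Qed.

(** One factor [d] serves all norms: for finite exponent [q], the sum of [q]-th powers is at most
    [d * u ^ q <= (d * u) ^ q]. *)
Lemma tdist_le x y (u : R) : (0 < d)%N -> in_unit x -> in_unit y ->
  (forall i, circ (x i) (y i) <= u) -> tdist p x y <= d%:R * u.
Proof.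
move=> d0 x01 y01 cu; have c0 j : 0 <= circ (x j) (y j) by exact: circ_ge0.
have u0 : 0 <= u by apply: le_trans (c0 (Ordinal d0)) (cu _).
have d1 : 1 <= d%:R :> R by rewrite ler1n.
case: p p_ok => [q|] /= ok; last first.
  by apply: bigmax_le => [|i _]; [rewrite mulr_ge0|rewrite (le_trans (cu i))// ler_peMl].
rewrite -(@exprn_powR_inv (d%:R * u) _ ok); last by rewrite mulr_ge0.
apply: ge0_ler_powR.
- by rewrite invr_ge0.
- by rewrite nnegrE sumr_ge0// => j _; rewrite exprn_ge0.
- by rewrite nnegrE exprn_ge0// mulr_ge0.
- apply: (@le_trans _ _ (\sum_(i < d) u ^+ q)).
    by apply: ler_sum => i _; apply: lerXn2r; rewrite ?nnegrE.
  have -> : \sum_(i < d) u ^+ q = d%:R * u ^+ q by rewrite sumr_const card_ord mulr_natl.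
  rewrite exprMn ler_wpM2r ?exprn_ge0//.
  by rewrite ler_eXnr.
Qed.

Variable T : R.
Hypothesis T_gt0 : 0 < T.
Let al := T^-1.
Let bet := (2^-1 : R) `^ al.

Lemma connw_far (wv B r : R) j x y : 0 < wv -> 0 < B -> in_unit x -> in_unit y ->
  0 <= r -> r ^+ d = wv * 2 ^+ j.+1 / B -> ~~ near_pt r x y ->
  connw p T wv x y <= B `^ al * bet ^+ j.+1.
Proof.
move=> w0 B0 x01 y01 r0 rd; rewrite negb_forall => /existsP[i]; rewrite -leNgt => ri.
have rt : r <= tdist p x y by apply: le_trans ri _; exact: circ_le_tdist.
have t0 := le_trans r0 rt.
have rd0 : 0 < r ^+ d by rewrite rd divr_gt0// mulr_gt0// exprn_gt0.
have rdt : r ^+ d <= tdist p x y ^+ d by apply: lerXn2r; rewrite ?nnegrE.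
have al0 : 0 <= al by rewrite invr_ge0 ltW.
have -> : B `^ al * bet ^+ j.+1 = (B * 2^-1 ^+ j.+1) `^ al.
  rewrite powRM; [|exact: ltW|by rewrite exprn_ge0// invr_ge0].
  congr (_ * _); rewrite /bet -powR_mulrn ?powR_ge0// powRAC powR_mulrn//.
rewrite /connw; apply: ge0_ler_powR => //.
- by rewrite nnegrE divr_ge0 ?exprn_ge0// ltW.
- by rewrite nnegrE mulr_ge0 ?exprn_ge0 ?invr_ge0// ltW.
rewrite ler_pdivrMr ?(lt_le_trans rd0)//.
apply: le_trans (ler_wpM2l _ rdt); last first.
  by rewrite mulr_ge0 ?exprn_ge0 ?invr_ge0// ltW.
rewrite rd; have p2 : (2 ^+ j.+1 : R) != 0 by rewrite expf_neq0// pnatr_eq0.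
rewrite exprVn le_eqVlt; apply/orP; left; apply/eqP.
by field; rewrite p2 gt_eqF.
Qed.

(* Each dyadic shell [B / 2^(j+1) < wv / dist^d <= B / 2^j] contributes at most
   [B^al * bet^j]; the shells beyond the [J]-th are bounded by [bet^J]. *)
Lemma connw_dyadic (wv B : R) (r : nat -> R) J x y :
  0 < wv -> 0 < B -> in_unit x -> in_unit y ->
  (forall j, 0 <= r j) -> (forall j, r j ^+ d = wv * 2 ^+ j.+1 / B) ->
  ~~ near_pt (r 0%N) x y ->
  connw p T wv x y <=
    B `^ al * (\sum_(j < J) bet ^+ j * (near_pt (r j) x y)%:R + bet ^+ J).
Proof.
move=> w0 B0 x01 y01 r0 rd nr.
have bet0 : 0 <= bet by exact: powR_ge0.
have Bal0 : 0 <= B `^ al by exact: powR_ge0.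
have bet1 : bet <= 1.
  apply: (@le_trans _ _ ((2^-1) `^ 0)); last by rewrite powRr0.
  by apply: ger_powR; [apply/andP; split; lra|rewrite invr_ge0 ltW].
elim: J => [|J IH].
  rewrite big_ord0 add0r expr0; apply: le_trans (connw_far w0 B0 x01 y01 _ (rd 0%N) nr) _ => //.
  by rewrite ler_wpM2l// expr1.
(* Inside the [J]-th box the new summand [bet ^+ J] replaces the old tail; outside it [connw_far]
   already gives the new tail [bet ^+ J.+1]. *)
have [h|h] := boolP (near_pt (r J) x y).
  apply: (le_trans IH); rewrite ler_wpM2l// big_ord_recr /= h mulr1.
  by rewrite lerDl exprn_ge0.
apply: (le_trans (connw_far w0 B0 x01 y01 _ (rd J) h)) => //.
rewrite ler_wpM2l// lerDr sumr_ge0// => j _.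
by rewrite mulr_ge0// exprn_ge0.
Qed.

(** Weights are at least 1, so closeness alone gives a lower bound. Positivity of the distance
    excludes division by zero, whose value 0 would break it. *)
Lemma connw_close (wv u : R) x y : (0 < d)%N -> 1 <= wv -> in_unit x -> in_unit y ->
  0 < tdist p x y -> (forall i, circ (x i) (y i) <= u) ->
  ((d%:R * u) ^- d) `^ al <= connw p T wv x y.
Proof.
move=> d0 w1 x01 y01 t0 cu.
have tu := tdist_le d0 x01 y01 cu.
have du0 := lt_le_trans t0 tu.
rewrite /connw; apply: ge0_ler_powR.
- by rewrite invr_ge0 ltW.
- by rewrite nnegrE invr_ge0 exprn_ge0// ltW.
- by rewrite nnegrE divr_ge0 ?exprn_ge0// ?(ltW t0)// (le_trans ler01).
apply: (@le_trans _ _ (tdist p x y ^- d)).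
  rewrite lef_pV2 ?posrE ?exprn_gt0//; apply: lerXn2r => //; rewrite nnegrE; exact: ltW.
by rewrite ler_peMl// invr_ge0 exprn_ge0// ltW.
Qed.

Lemma in_cell_circ L (e : {ffun 'I_d -> 'I_L}) x y i : (0 < L)%N ->
  in_cell e x -> in_cell e y -> circ (x i) (y i) <= L%:R^-1.
Proof.
move=> L0 /forallP/(_ i)/andP[a b] /forallP/(_ i)/andP[a' b'].
rewrite /circ ge_min; apply/orP; left; rewrite ler_norml.
by move: b b'; rewrite -natr1 mulrDl mul1r => b b'; apply/andP; split; lra.
Qed.

End Distance.

(** * Good clauses and rich cells *)

Section GoodClauses.
Variables (R : realType) (d k n L : nat) (bet : R) (rho : 'I_n -> nat -> R).
Local Notation cell := {ffun 'I_d -> 'I_L}.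
Local Notation Om := (Om R).
Implicit Types (x : 'I_d -> R) (V : 'I_n -> 'I_d -> R).

(* [rho v j] will be the radius at which [w_v / dist^d = B / 2^(j+1)], and
   [bet = 2^(-1/T)]: [B^(1/T) * load] bounds the total connection weight of [x]. *)
Definition load x V : R :=
  \sum_(v < n) \sum_(j < n) bet ^+ j * (near_pt (rho v j) x (V v))%:R.

Definition rich V (e : cell) : bool := k%:R <= \sum_(v < n) (in_cell e (V v))%:R :> R.

(** The first condition bounds the total connection weight and also keeps [x] out of every innermost
    box, as such a box alone adds 1 to the load. The second provides [k] heavy variables. *)
Definition good x V : bool :=
  (load x V < 1) && [exists e, rich V e && in_cell e x].

Definition many_rich V : bool := (L ^ d)%:R / 2 <= \sum_e (rich V e)%:R :> R.

(* If fewer than half of the cells are rich, the set [A] of the others contains at most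
   [k * L ^ d] variables, and its summand alone is at least 1. *)
Definition poor_weight V : R :=
  \sum_(A : {set cell} | ((L ^ d)%:R / 2 <= #|A|%:R :> R)%R) 2 ^+ (k * L ^ d) *
    \prod_(v < n) (1 - 2^-1 * ([exists e, (e \in A) && in_cell e (V v)])%:R).

Section Meas.
Local Open Scope classical_set_scope.
Context {dT : measure_display} {T : measurableType dT}.
Variables (x : T -> 'I_d -> R) (V : T -> 'I_n -> 'I_d -> R).
Hypothesis mx : forall i, measurable_fun [set: T] (x^~ i).
Hypothesis mV : forall v i, measurable_fun [set: T] (fun t => V t v i).

Lemma measurable_load : measurable_fun [set: T] (fun t => load (x t) (V t)).
Proof.
apply: measurable_sum_fin => v; apply: measurable_sum_fin => j.
apply: measurable_funM => //.
by apply: measurable_natr_bool; apply: measurable_near_pt.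
Qed.

Lemma measurable_rich e : measurable_fun [set: T] (fun t => rich (V t) e).
Proof.
apply: measurable_fun_ler => //; apply: measurable_sum_fin => v.
by apply: measurable_natr_bool; apply: measurable_in_cell.
Qed.

Lemma measurable_good : measurable_fun [set: T] (fun t => good (x t) (V t)).
Proof.
apply: measurable_and.
  by apply: measurable_fun_ltr => //; exact: measurable_load.
apply: measurable_exists => e; apply: measurable_and; first exact: measurable_rich.
exact: measurable_in_cell.
Qed.

Lemma measurable_many_rich : measurable_fun [set: T] (fun t => many_rich (V t)).
Proof.
apply: measurable_fun_ler => //; apply: measurable_sum_fin => e.
by apply: measurable_natr_bool; exact: measurable_rich.
Qed.

Lemma measurable_in_cells (A : {set cell}) v :
  measurable_fun [set: T]
    (fun t => ([exists e, (e \in A) && in_cell e (V t v)])%:R : R).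
Proof.
apply: measurable_natr_bool; apply: measurable_exists => e.
apply: measurable_and; first exact: measurable_cst.
exact: measurable_in_cell.
Qed.

Lemma measurable_poor_weight : measurable_fun [set: T] (fun t => poor_weight (V t)).
Proof.
apply: measurable_sum_fin => A; apply: measurable_funM => //.
apply: measurable_prod => v _; apply: measurable_funB => //.
by apply: measurable_funM => //; exact: measurable_in_cells.
Qed.

End Meas.

Hypothesis d_gt0 : (0 < d)%N.
Hypothesis L_gt0 : (0 < L)%N.
Hypothesis bet_ge0 : 0 <= bet.
Hypothesis rho_ge0 : forall v j, 0 <= rho v j.

Lemma load_ge0 x V : 0 <= load x V.
Proof.
by apply: sumr_ge0 => v _; apply: sumr_ge0 => j _; rewrite mulr_ge0// exprn_ge0.
Qed.

Lemma card_cell : #|{: cell}| = (L ^ d)%N.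
Proof. by rewrite card_ffun !card_ord. Qed.

Lemma Ld_gt0 : 0 < (L ^ d)%:R :> R.
Proof. by rewrite ltr0n expn_gt0 L_gt0. Qed.

Lemma measurable_pos j i : measurable_fun setT (fun y : Om => @pos R d y j i).
Proof. exact: measurable_coord. Qed.

Lemma EX_cells (P : pred cell) :
  EX d (fun y => \sum_(e | P e) (in_cell e (@pos R d y 0))%:R) =
  (\sum_(e | P e) (L ^ d)%:R^-1)%R%:E.
Proof.
rewrite EX_sum//; last first.
  by move=> e; apply: measurable_natr_bool; apply: measurable_in_cell => i; exact: measurable_pos.
by under eq_bigr do rewrite EX_in_cell//; rewrite sumEFin natrX.
Qed.

(** A union bound over the two ways of failing; the sum is the indicator of lying in a rich cell. *)
Lemma not_good_le x V : 1 - (good x V)%:R <=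
  load x V + (1 - \sum_(e | rich V e) (in_cell e x)%:R).
Proof.
rewrite sum_in_cell// /good; have := load_ge0 x V.
case: ltP => h1 h2; case: [exists _, _] => /=; lra.
Qed.

Lemma EX_load_le V : (forall v, in_unit (V v)) ->
  (EX d (fun y => load (@pos R d y 0) V) <=
   (\sum_(v < n) \sum_(j < n) bet ^+ j * (6 * rho v j) ^+ d)%R%:E)%E.
Proof.
move=> V01.
have mn v j : measurable_fun setT (fun y : Om => (near_pt (rho v j) (@pos R d y 0) (V v))%:R : R).
  apply: measurable_natr_bool; apply: measurable_near_pt => i //.
  exact: measurable_pos.
rewrite /load EX_sum; last 2 first.
- by move=> v; apply: measurable_sum_fin => j; apply: measurable_funM.
- by move=> v y; apply: sumr_ge0 => j _; rewrite mulr_ge0// exprn_ge0.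
rewrite -sumEFin; apply: lee_sum => v _; rewrite EX_sum; last 2 first.
- by move=> j; apply: measurable_funM.
- by move=> j y; rewrite mulr_ge0// exprn_ge0.
rewrite -sumEFin; apply: lee_sum => j _; rewrite EX_scale// ?exprn_ge0//.
by rewrite EFinM lee_wpmul2l ?lee_fin ?exprn_ge0// EX_near_pt_le.
Qed.

(** By Markov's inequality the load is too large with probability at most 1/4, and the rich cells
    have total volume at least 1/2. A clause is thus good with probability at least 1/4. *)
Lemma EX_not_good_le V (gam : R) : 0 <= gam <= 1 -> (forall v, in_unit (V v)) ->
  \sum_(v < n) \sum_(j < n) bet ^+ j * (6 * rho v j) ^+ d <= 4^-1 ->
  many_rich V ->
  (EX d (fun y => 1 - gam / 2 * (good (@pos R d y 0) V)%:R)%R <= (1 - gam / 8)%R%:E)%E.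
Proof.
move=> /andP[g0 g1] V01 Hload Hrich.
have mcst v i : measurable_fun setT (fun _ : Om => V v i) by exact: measurable_cst.
have mpos := measurable_pos 0.
have ml : measurable_fun setT (fun y : Om => load (@pos R d y 0) V).
  exact: measurable_load.
have mS : measurable_fun setT (fun y : Om =>
    \sum_(e | rich V e) (in_cell e (@pos R d y 0))%:R : R).
  by apply: measurable_sum_fin => e; apply: measurable_natr_bool; apply: measurable_in_cell.
have S01 y : (0 : R) <= \sum_(e | rich V e) (in_cell e (@pos R d y 0))%:R <= (1 : R).
  by rewrite !sum_in_cell// ler0n lern1 leq_b1.
have l0 y := load_ge0 (@pos R d y 0) V.
have mS' : measurable_fun setT (fun y : Om =>
    1 - \sum_(e | rich V e) (in_cell e (@pos R d y 0))%:R : R) by exact: measurable_funB.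
have mr : measurable_fun setT (fun y : Om => load (@pos R d y 0) V +
    (1 - \sum_(e | rich V e) (in_cell e (@pos R d y 0))%:R)) by exact: measurable_funD.
have a0 y : 0 <= load (@pos R d y 0) V +
    (1 - \sum_(e | rich V e) (in_cell e (@pos R d y 0))%:R).
  by have /andP[a b] := S01 y; have := l0 y => c; lra.
apply: (@le_trans _ _ (EX d (fun y => (1 - gam / 2) + gam / 2 *
   (load (@pos R d y 0) V + (1 - \sum_(e | rich V e) (in_cell e (@pos R d y 0))%:R))))).
  apply: EX_le.
  - apply: measurable_funB => //; apply: measurable_funM => //.
    by apply: measurable_natr_bool; exact: measurable_good.
  - by apply: measurable_funD => //; apply: measurable_funM.
  - by move=> y; case: (good _ _) => /=; lra.
  - by move=> y; apply: addr_ge0; [lra|apply: mulr_ge0; [lra|exact: a0]].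
  - move=> y _; have := not_good_le (@pos R d y 0) V => h.
    have g2 : 0 <= gam / 2 by lra.
    by have := ler_wpM2l g2 h; rewrite !mulrBr mulr1; lra.
rewrite EX_add//; last 3 first.
- by apply: measurable_funM.
- by move=> y; lra.
- by move=> y; rewrite mulr_ge0//; lra.
rewrite EX_scale//; last by lra.
rewrite EX_cst EX_add//; last by move=> y; have /andP[a b] := S01 y; lra.
have -> := EX_compl (f := fun y => 1 - \sum_(e | rich V e) (in_cell e (@pos R d y 0))%:R)
  mS' mS _ _ _ (EX_cells (rich V)); first last.
- by move=> y; rewrite subrK.
- by move=> y; have /andP[] := S01 y.
- by move=> y; have /andP[a b] := S01 y; lra.
have half : 2^-1 <= \sum_(e | rich V e) (L ^ d)%:R^-1 :> R.
  have -> : \sum_(e | rich V e) (L ^ d)%:R^-1 = (\sum_e (rich V e)%:R) / (L ^ d)%:R :> R.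
    rewrite mulr_suml [LHS]big_mkcond; apply: eq_bigr => e _.
    by case: (rich V e); rewrite /= ?mul1r ?mul0r.
  by rewrite ler_pdivlMr ?Ld_gt0// mulrC.
apply: (@le_trans _ _ ((1 - gam / 2) + gam / 2 * (4^-1 + 2^-1))%:E); last first.
  by rewrite lee_fin; lra.
rewrite [leRHS]EFinD; apply: leeD2l; rewrite [leRHS]EFinM; apply: lee_wpmul2l; first by rewrite lee_fin; lra.
rewrite [leRHS]EFinD; apply: leeD; last by rewrite lee_fin; lra.
by apply: le_trans (EX_load_le V01) _; rewrite lee_fin.
Qed.

Lemma poor_weight_ge0 V : 0 <= poor_weight V.
Proof.
apply: sumr_ge0 => A _; rewrite mulr_ge0 ?exprn_ge0// prodr_ge0// => v _.
by case: [exists _, _] => /=; lra.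
Qed.

Lemma poor_weight_ge1 V : ~~ many_rich V -> 1 <= poor_weight V.
Proof.
rewrite -ltNge => H; pose A := [set e : cell | ~~ rich V e].
have cA : (L ^ d)%:R = #|A|%:R + \sum_e (rich V e)%:R :> R.
  have -> : (L ^ d)%:R = \sum_(e : cell) 1 :> R by rewrite sumr_const card_cell.
  rewrite -sum1_card natr_sum [X in X + _]big_mkcond -big_split /=.
  by apply: eq_bigr => e _; rewrite inE; case: (rich V e); rewrite /= ?addr0 ?add0r.
have hA : (L ^ d)%:R / 2 <= #|A|%:R :> R by move: H; lra.
rewrite /poor_weight (bigD1 A)//=; apply: ler_wpDr.
  apply: sumr_ge0 => B _; rewrite mulr_ge0 ?exprn_ge0// prodr_ge0// => v _.
  by case: [exists _, _] => /=; lra.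
pose b v : bool := [exists e, (e \in A) && in_cell e (V v)].
have -> : \prod_(v < n) (1 - 2^-1 * (b v)%:R) = 2^-1 ^+ (\sum_v b v) :> R.
  by rewrite expr_sum; apply: eq_bigr => v _; case: (b v); rewrite /= ?expr0 ?expr1; lra.
have hb : (\sum_v b v <= k * L ^ d)%N.
  rewrite -(ler_nat R) natr_sum.
  have -> : \sum_(v < n) (b v)%:R = \sum_(e in A) \sum_(v < n) (in_cell e (V v))%:R :> R.
    by rewrite exchange_big /=; apply: eq_bigr => v _; rewrite sum_in_cell.
  apply: (@le_trans _ _ (\sum_(e in A) k%:R)).
    by apply: ler_sum => e; rewrite inE /rich -ltNge => /ltW.
  rewrite sumr_const -mulrnA ler_nat leq_mul2l -card_cell max_card.
  by rewrite orbT.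
rewrite -(subnKC hb) exprD.
have -> : 2 ^+ (\sum_v b v) * 2 ^+ (k * L ^ d - \sum_v b v) * 2^-1 ^+ (\sum_v b v) =
    2 ^+ (k * L ^ d - \sum_v b v) :> R.
  by rewrite mulrAC -exprMn divff ?expr1n ?mul1r// pnatr_eq0.
by rewrite exprn_ege1// ler1n.
Qed.

(** A set [A] of at least half of the cells catches a variable with probability at least 1/2, so
    each factor has expectation at most [1 - 1/2 * 1/2 = 3 / 4]. The [2 ^ (L ^ d)] choices of [A]
    raise the exponent from [k] to [k.+1]. *)
Lemma EX_poor_weight_le :
  (EX (n * d) (fun y => poor_weight (fun v => @pos R d y v)) <=
   (2 ^+ (k.+1 * L ^ d) * (3 / 4) ^+ n)%R%:E)%E.
Proof.
pose h (A : {set cell}) x : R := 1 - 2^-1 * ([exists e, (e \in A) && in_cell e x])%:R.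
have h0 A x : 0 <= h A x by rewrite /h; case: [exists _, _] => /=; lra.
have mh A j : measurable_fun setT (fun y : Om => h A (@pos R d y j)).
  apply: measurable_funB => //; apply: measurable_funM => //.
  apply: measurable_natr_bool; apply: measurable_exists => e; apply: measurable_and => //.
  by apply: measurable_in_cell => i; exact: measurable_pos.
have mP A : measurable_fun setT (fun y : Om => \prod_(v < n) h A (@pos R d y v)).
  by apply: measurable_prod.
have P0 A (y : Om) : 0 <= \prod_(v < n) h A (@pos R d y v) by exact: prodr_ge0.
have hE (A : {set cell}) : (L ^ d)%:R / 2 <= #|A|%:R :> R ->
    (EX d (fun y => h A (@pos R d y 0)) <= (3 / 4)%R%:E)%E.
  move=> hA.
  pose s (y : Om) : R := \sum_(e in A) (in_cell e (@pos R d y 0))%:R.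
  have sE y : s y = ([exists e, (e \in A) && in_cell e (@pos R d y 0)])%:R.
    by rewrite /s sum_in_cell.
  have ms : measurable_fun setT s.
    apply: measurable_sum_fin => e; apply: measurable_natr_bool.
    by apply: measurable_in_cell => i; exact: measurable_pos.
  have := @EX_compl R d (fun y => h A (@pos R d y 0)) (fun y => 2^-1 * s y)
    (2^-1 * (\sum_(e in A) (L ^ d)%:R^-1)) (mh A 0%N).
  move=> -> //.
  - rewrite lee_fin sumr_const -mulr_natr.
    have : 2^-1 <= (L ^ d)%:R^-1 * #|A|%:R :> R.
      by rewrite mulrC ler_pdivlMr ?Ld_gt0// mulrC.
    lra.
  - exact: measurable_funM.
  - by move=> y; rewrite mulr_ge0// sE.
  - by move=> y; rewrite sE /h subrK.
  - rewrite EX_scale//; last by move=> y; rewrite sE.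
    by rewrite EX_cells EFinM.
rewrite /poor_weight EX_sum; last 2 first.
- by move=> A; apply: measurable_funM => //; exact: mP.
- by move=> A y; rewrite mulr_ge0 ?exprn_ge0//; exact: P0.
apply: (@le_trans _ _ (\sum_(A : {set cell} | ((L ^ d)%:R / 2 <= #|A|%:R :> R)%R)
    (2 ^+ (k * L ^ d) * (3 / 4) ^+ n)%R%:E)%E).
  apply: lee_sum => A hA; rewrite EX_scale ?exprn_ge0//; [|exact: mP|exact: P0].
  rewrite EFinM lee_wpmul2l ?lee_fin ?exprn_ge0//.
  have := @EX_blocks_le R d n (fun=> h A) (fun=> 3 / 4) (fun _ => mh A 0%N)
    (fun _ => h0 A) (fun _ => hE A hA).
  by rewrite prodr_const card_ord.
rewrite sumEFin lee_fin sumr_const -[leLHS]mulr_natl.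
have -> : 2 ^+ (k.+1 * L ^ d) * (3 / 4) ^+ n =
   (2 ^+ (L ^ d)) * (2 ^+ (k * L ^ d) * (3 / 4) ^+ n) :> R.
  by rewrite mulSn exprD mulrA.
rewrite ler_wpM2r//.
rewrite -natrX ler_nat -card_cell -cardsT.
have <- : #|{: {set cell}}| = (2 ^ #|[set: cell]|)%N by rewrite -card_powerset powersetT cardsT.
exact: max_card.
Qed.

End GoodClauses.

(** * Good clauses are nice with constant probability *)

(** This is where [T < 1] enters: from one dyadic shell to the next the volume doubles and the
    weight shrinks by [bet], so the series has ratio [2 * bet < 1]. *)
Lemma half_powR_lt (R : realType) (al : R) : 1 < al -> (2^-1 : R) `^ al < 2^-1.
Proof.
move=> al1; rewrite -mulr_powRB1 ?invr_ge0//; last by rewrite (lt_trans ltr01).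
rewrite gtr_pMr ?invr_gt0// /powR gt_eqF ?invr_gt0// expR_lt1.
by rewrite pmulr_rlt0 ?subr_gt0// ln_lt0// invr_gt0 ltr0n invf_lt1 ?ltr1n.
Qed.

Section NiceProbability.
Variables (R : realType) (d k n L : nat) (p : pnorm) (T B r0 : R).
Variables (w : 'I_n -> R) (rho : 'I_n -> nat -> R).
Let al := T^-1.
Let bet := (2^-1 : R) `^ al.
Hypothesis d_gt0 : (0 < d)%N.
Hypothesis L_gt0 : (0 < L)%N.
Hypothesis p_ok : pnorm_ok p.
Hypothesis T_gt0 : 0 < T.
Hypothesis B_gt0 : 0 < B.
Hypothesis r0_gt0 : 0 < r0.
Hypothesis w_ge1 : forall v, 1 <= w v.
Hypothesis rho_ge0 : forall v j, 0 <= rho v j.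
Hypothesis rhoE : forall v j, rho v j ^+ d = w v * 2 ^+ j.+1 / B.

Variables (x : 'I_d -> R) (V : 'I_n -> 'I_d -> R).
Hypothesis x01 : in_unit x.
Hypothesis V01 : forall v, in_unit (V v).
Hypothesis far : forall v, ~~ near_pt r0 x (V v).

Local Notation X := (fun v => connw p T (w v) x (V v)).

Lemma tdist_gt0 v : 0 < tdist p x (V v).
Proof.
have := far v; rewrite negb_forall => /existsP[i]; rewrite -leNgt => h.
by apply: lt_le_trans r0_gt0 (le_trans h _); exact: circ_le_tdist.
Qed.

Lemma connw_gt0 v : 0 < X v.
Proof.
rewrite /connw powR_gt0// divr_gt0 ?exprn_gt0 ?tdist_gt0//.
exact: lt_le_trans ltr01 _.
Qed.

Lemma good_sum_connw : good k L bet rho x V -> bet <= 2^-1 ->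
  \sum_v X v <= B `^ al * 2.
Proof.
move=> /andP[ld _] bet2.
have bet0 : 0 <= bet by exact: powR_ge0.
(* With [J = n] shells, the tails of all [n] variables together add at most 1 to the load. *)
have n2 : n%:R * bet ^+ n <= 1.
  apply: (@le_trans _ _ (n%:R * 2^-1 ^+ n)).
    by rewrite ler_wpM2l// lerXn2r ?nnegrE// invr_ge0.
  by rewrite exprVn ler_pdivrMr ?exprn_gt0// mul1r -natrX ler_nat ltnW// ltn_expl.
have w0 v : 0 < w v by exact: lt_le_trans ltr01 _.
have nr v : ~~ near_pt (rho v 0%N) x (V v).
  apply/negP => h; move: ld; rewrite ltNge => /negP; apply.
  have n0 : (0 < n)%N by apply: leq_trans (ltn_ord v).
  rewrite /load (bigD1 v)//= (bigD1 (Ordinal n0))//= h expr0 mulr1 -addrA lerDl.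
  rewrite addr_ge0 ?sumr_ge0// => [j _|u _]; first by rewrite mulr_ge0// exprn_ge0.
  by rewrite sumr_ge0// => j _; rewrite mulr_ge0// exprn_ge0.
apply: (@le_trans _ _ (B `^ al * (load bet rho x V + n%:R * bet ^+ n))).
  have -> : n%:R * bet ^+ n = \sum_(v < n) bet ^+ n.
    by rewrite sumr_const card_ord mulr_natl.
  rewrite /load -big_split mulr_sumr; apply: ler_sum => v _.
  by apply: connw_dyadic.
by rewrite ler_wpM2l ?powR_ge0//; lra.
Qed.

(** The [k] variables sharing the cell of [x] are within [d / L] of it, and [good_sum_connw] bounds
    the normaliser of each draw. *)
Lemma good_nice : good k L bet rho x V -> bet <= 2^-1 ->
  (((d%:R / L%:R) ^- d) `^ al / (B `^ al * 2)) ^+ k <=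
  \sum_(s : k.-tuple 'I_n | nice X s) draw_prob X s.
Proof.
move=> gx bet2; have SX := good_sum_connw gx bet2.
case/andP: gx => _ /existsP[e /andP[re ex]].
apply: prob_nice_lower => //.
- exact: connw_gt0.
- by rewrite powR_gt0// invr_gt0 exprn_gt0// divr_gt0// ltr0n.
rewrite -(ler_nat R); apply: (le_trans re).
rewrite -sum1_card natr_sum [leRHS]big_mkcond; apply: ler_sum => v _.
rewrite inE; case: (boolP (in_cell e (V v))) => ev /=; last by case: ifP.
rewrite ifT//; apply: connw_close => //; first exact: tdist_gt0.
by move=> i; exact: in_cell_circ ex ev.
Qed.

End NiceProbability.

(** * The grid size and the coordinate blocks of variables and clauses *)

Lemma max_grid (d K n : nat) : (0 < d)%N -> (0 < K)%N -> (K <= n)%N ->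
  exists L, [/\ (0 < L)%N, (K * L ^ d <= n)%N & (n <= K * 2 ^ d * L ^ d)%N].
Proof.
move=> d0 K0 Kn; pose P L := (K * L ^ d <= n)%N.
have P1 : exists L, P L by exists 1%N; rewrite /P exp1n muln1.
have PB L : P L -> (L <= n)%N.
  move=> h; apply: leq_trans h; apply: (@leq_trans (L ^ d)%N); last exact: leq_pmull.
  by case: L => // L; rewrite -{1}(expn1 L.+1) leq_pexp2l.
case: (ex_maxnP P1 PB) => L PL maxL; exists L.
have L0 : (0 < L)%N by apply: maxL; rewrite /P exp1n muln1.
split => //; rewrite leqNgt; apply/negP => h.
have : P L.+1.
  (* If [n] exceeded [K * (2 * L) ^ d], then [L + 1 <= 2 * L] would also be admissible, against
     maximality. *)
  rewrite /P; apply: leq_trans (ltnW h); rewrite -mulnA leq_mul2l -expnMn.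
  by rewrite leq_exp2r// mul2n -addnn -addn1 leq_add2l L0 orbT.
by move/maxL; rewrite ltnn.
Qed.

Section Blocks.
Variable R : realType.
Local Notation Om := (Om R).

Lemma pos_splice_l d n (y z : Om) (v : nat) : (v < n)%N ->
  @pos R d (splice (n * d) y z) v = @pos R d y v.
Proof.
move=> vn; apply/funext => i; rewrite /pos /splice ifT//.
apply: (@leq_trans (v.+1 * d)); last by rewrite leq_mul2r vn orbT.
by rewrite mulSn addnC ltn_add2r.
Qed.

Lemma pos_splice_r d n (y z : Om) (c : nat) :
  @pos R d (splice (n * d) y z) (n + c) = @pos R d z c.
Proof.
apply/funext => i; rewrite /pos /splice mulnDl -addnA ltnNge leq_addr /=.
by rewrite addKn.
Qed.

Lemma pos_in_unit d n (y : Om) (v : nat) : in_cube (n * d) y -> (v < n)%N ->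
  in_unit (@pos R d y v).
Proof.
move=> y01 vn i; apply: y01.
apply: (@leq_trans (v.+1 * d)); last by rewrite leq_mul2r vn orbT.
by rewrite mulSn addnC ltn_add2r.
Qed.

Lemma EX_block_le d m (c : 'I_m) (h : ('I_d -> R) -> R) (e : R) :
  measurable_fun setT (fun y : Om => h (@pos R d y 0)) -> (forall x, 0 <= h x) ->
  (EX d (fun y => h (@pos R d y 0)) <= e%:E)%E ->
  (EX (m * d) (fun y => h (@pos R d y c)) <= e%:E)%E.
Proof.
move=> mh h0 he.
have := @EX_blocks_le R d m (fun i => if i == c then h else fun=> 1)
  (fun i => if i == c then e else 1).
have -> : \prod_(i < m) (if i == c :> nat then e else 1) = e.
  rewrite (bigD1 c)//= eqxx big1 ?mulr1// => i ic.
  by rewrite ifN.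
have -> : (fun y : Om => \prod_(i < m) (if i == c :> nat then h else fun=> 1) (@pos R d y i)) =
    (fun y : Om => h (@pos R d y c)).
  apply/funext => y; rewrite (bigD1 c)//= eqxx big1 ?mulr1// => i ic.
  by rewrite ifN.
apply => i; case: ifP => // _; by rewrite EX_cst.
Qed.

End Blocks.

(** * Assembling the bound *)

Section LowerBound.
Variables (R : realType) (d k n m L : nat) (p : pnorm) (T B r0 gam : R).
Variables (w : 'I_n -> R) (rho : 'I_n -> nat -> R).
Let al := T^-1.
Let bet := (2^-1 : R) `^ al.
Local Notation Om := (Om R).
Hypothesis d_gt0 : (0 < d)%N.
Hypothesis L_gt0 : (0 < L)%N.
Hypothesis k_le_n : (k <= n)%N.
Hypothesis p_ok : pnorm_ok p.
Hypothesis T_gt0 : 0 < T.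
Hypothesis T_lt1 : T < 1.
Hypothesis B_gt0 : 0 < B.
Hypothesis r0_gt0 : 0 < r0.
Hypothesis w_ge1 : forall v, 1 <= w v.
Hypothesis rho_ge0 : forall v j, 0 <= rho v j.
Hypothesis rhoE : forall v j, rho v j ^+ d = w v * 2 ^+ j.+1 / B.
Hypothesis load_small :
  \sum_(v < n) \sum_(j < n) bet ^+ j * (6 * rho v j) ^+ d <= 4^-1.
Hypothesis gam01 : 0 <= gam <= 1.
Hypothesis gam_le :
  gam <= (((d%:R / L%:R) ^- d) `^ al / (B `^ al * 2)) ^+ k.

Let vars (y : Om) : 'I_n -> 'I_d -> R := fun v => @pos R d y v.
Let clause (y : Om) (c : 'I_m) : 'I_d -> R := @pos R d y (n + c).

(* The event fails with conditional probability at most the sum of the three terms: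
   too few nice draws, too few rich cells, or a clause so close to a variable that the
   distance might vanish, where [connw] takes the junk value 0. *)
Let fail_draws (y : Om) : R := (many_rich k L (vars y))%:R *
  (expR (gam / 16 * m%:R) *
   \prod_(c < m) (1 - gam / 2 * (good k L bet rho (clause y c) (vars y))%:R)).

Let fail_poor (y : Om) : R := poor_weight k L (vars y).

Let fail_near (y : Om) : R :=
  \sum_(c < m) \sum_(v < n) (near_pt r0 (clause y c) (vars y v))%:R.

Let bet0 : 0 <= bet. Proof. exact: powR_ge0. Qed.

Let al_gt1 : 1 < al. Proof. by rewrite invf_gt1. Qed.

Let bet_le : bet <= 2^-1. Proof. by apply/ltW/half_powR_lt. Qed.

Let factor_ge0 (b : bool) : 0 <= 1 - gam / 2 * b%:R.
Proof. by case/andP: gam01 => ? ?; case: b => /=; lra. Qed.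

Let fail_draws_ge0 y : 0 <= fail_draws y.
Proof. by rewrite mulr_ge0// mulr_ge0 ?expR_ge0// prodr_ge0. Qed.

Let fail_poor_ge0 y : 0 <= fail_poor y.
Proof. exact: poor_weight_ge0. Qed.

Let fail_near_ge0 y : 0 <= fail_near y.
Proof. by apply: sumr_ge0 => c _; apply: sumr_ge0. Qed.

Let mvars v i : measurable_fun setT (fun y : Om => vars y v i).
Proof. exact: measurable_coord. Qed.

Let mclause c i : measurable_fun setT (fun y : Om => clause y c i).
Proof. exact: measurable_coord. Qed.

Let measurable_fail_draws : measurable_fun setT fail_draws.
Proof.
apply: measurable_funM.
  by apply: measurable_natr_bool; exact: measurable_many_rich.
apply: measurable_funM => //; apply: measurable_prod => c _.
apply: measurable_funB => //; apply: measurable_funM => //.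
by apply: measurable_natr_bool; apply: measurable_good => //; exact: mclause.
Qed.

Let measurable_fail_poor : measurable_fun setT fail_poor.
Proof. exact: measurable_poor_weight. Qed.

Let measurable_fail_near : measurable_fun setT fail_near.
Proof.
apply: measurable_sum_fin => c; apply: measurable_sum_fin => v.
apply: measurable_natr_bool; apply: measurable_near_pt => i.
  exact: mclause.
exact: mvars.
Qed.

Let vars_splice y z : vars (splice (n * d) y z) = vars y.
Proof. by apply/funext => v; rewrite /vars pos_splice_l. Qed.

Let clause_splice y z c : clause (splice (n * d) y z) c = @pos R d z c.
Proof. by rewrite /clause pos_splice_r. Qed.

Let vars_in_unit y : in_cube (n * d) y -> forall v, in_unit (vars y v).
Proof. by move=> y01 v; exact: (pos_in_unit y01 (ltn_ord v)). Qed.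

(** With the variables fixed, clauses are independent and each factor averages to at most
    [1 - gam / 8 <= exp(- gam / 8)]. This outweighs the prefactor [exp(gam * m / 16)]. *)
Let EX_fail_draws_le :
  (EX (n * d + m * d) fail_draws <= (expR (- (gam / 16) * m%:R))%:E)%E.
Proof.
apply: EX_splice_le => // y y01.
have mg c : measurable_fun setT
    (fun z : Om => 1 - gam / 2 * (good k L bet rho (@pos R d z c) (vars y))%:R).
  apply: measurable_funB => //; apply: measurable_funM => //.
  apply: measurable_natr_bool; apply: measurable_good => [i|v i].
    exact: measurable_coord.
  exact: measurable_cst.
under eq_fun => z.
  rewrite /fail_draws vars_splice mulrA.
  under eq_bigr do rewrite clause_splice.
  over.
rewrite EX_scale; last 3 first.
- by apply: measurable_prod => c _; exact: mg.
- by rewrite mulr_ge0// expR_ge0.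
- by move=> z; rewrite prodr_ge0.
have [rich|poor] := boolP (many_rich k L (vars y)); last first.
  by rewrite mul0r mul0e lee_fin expR_ge0.
have := @EX_blocks_le R d m (fun=> fun x => 1 - gam / 2 * (good k L bet rho x (vars y))%:R)
  (fun=> 1 - gam / 8) (fun _ => mg 0%N) (fun _ _ => factor_ge0 _) (fun _ =>
   EX_not_good_le d_gt0 L_gt0 bet0 rho_ge0 gam01 (vars_in_unit y01) load_small rich).
rewrite prodr_const card_ord mul1r => h.
apply: (@le_trans _ _ ((expR (gam / 16 * m%:R))%:E * ((1 - gam / 8) ^+ m)%:E)%E).
  by apply: lee_wpmul2l => //; rewrite lee_fin expR_ge0.
rewrite -EFinM lee_fin.
apply: (@le_trans _ _ (expR (gam / 16 * m%:R) * expR (- (gam / 8)) ^+ m)).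
  rewrite ler_pM2l ?expR_gt0//; apply: lerXn2r; rewrite ?nnegrE ?expR_ge0//.
    by case/andP: gam01 => ? ?; lra.
  by have := expR_ge1Dx (- (gam / 8)).
rewrite -expRM_natr -expRD ler_expR le_eqVlt; apply/orP; left; apply/eqP; lra.
Qed.

Let EX_fail_poor_le :
  (EX (n * d + m * d) fail_poor <= (2 ^+ (k.+1 * L ^ d) * (3 / 4) ^+ n)%:E)%E.
Proof.
rewrite (@EX_splice_fst R (n * d) (m * d) _ (fun y => poor_weight k L (vars y)))//.
  exact: EX_poor_weight_le.
by move=> y z; rewrite /fail_poor vars_splice.
Qed.

Let EX_fail_near_le :
  (EX (n * d + m * d) fail_near <= (n%:R * m%:R * (6 * r0) ^+ d)%:E)%E.
Proof.
apply: EX_splice_le => // y y01.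
under eq_fun => z.
  rewrite /fail_near vars_splice.
  under eq_bigr do rewrite clause_splice.
  over.
have mn (c : nat) v : measurable_fun setT
    (fun z : Om => (near_pt r0 (@pos R d z c) (vars y v))%:R : R).
  apply: measurable_natr_bool; apply: measurable_near_pt => i //.
  exact: measurable_coord.
rewrite EX_sum; last 2 first.
- by move=> c; apply: measurable_sum_fin => v; exact: mn.
- by move=> c z; apply: sumr_ge0.
apply: (@le_trans _ _ (\sum_(c < m) \sum_(v < n) ((6 * r0) ^+ d)%:E)%E).
  apply: lee_sum => c _; rewrite EX_sum//.
  apply: lee_sum => v _.
  apply: (@EX_block_le R d m c (fun x => (near_pt r0 x (vars y v))%:R)) => //.
  by apply: EX_near_pt_le => //; [exact: vars_in_unit|exact: ltW].
under eq_bigr do rewrite sumEFin; rewrite sumEFin lee_fin.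
by rewrite !sumr_const !card_ord -mulrnA -[leLHS]mulr_natl natrM.
Qed.

(** For bad positions one failure term is at least 1, so [1 - H] is at most 0 and the bound is
    trivial. For all others the inequality is [chernoff_lower] applied to the draws alone. *)
Lemma prob_nice_ge_lower :
  ((1 - (expR (- (gam / 16) * m%:R) + 2 ^+ (k.+1 * L ^ d) * (3 / 4) ^+ n +
         n%:R * m%:R * (6 * r0) ^+ d))%:E <=
   prob_nice_ge d k p T n m w (gam / 16 * m%:R))%E.
Proof.
rewrite /prob_nice_ge mulnDl.
pose H y := fail_draws y + fail_poor y + fail_near y.
have X_ge0 y (c : 'I_m) v : 0 <= connw p T (w v) (@pos R d y (n + c)) (@pos R d y v).
  exact: powR_ge0.
set F := (F in cube_int _ F).
have F_ge0 y : (0 <= F y)%E.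
  rewrite lee_fin sumr_ge0// => S _; rewrite mulr_ge0//; last by case: ifP.
  by apply: prodr_ge0 => c _; apply: draw_prob_ge0.
apply: (@cube_int_ge_compl R _ F H).
- by apply: measurable_funD => //; exact: measurable_funD.
- by move=> y; rewrite !addr_ge0.
- by move=> y _; exact: F_ge0.
- move=> y y01.
  have y01' v : (v < n + m)%N -> in_unit (@pos R d y v).
    by apply: pos_in_unit; rewrite mulnDl.
  have [nr|nnr] := boolP [exists c, exists v, near_pt r0 (clause y c) (vars y v)].
    apply: le_trans (F_ge0 y); rewrite lee_fin subr_le0.
    have : 1 <= fail_near y.
      case/existsP: nr => c /existsP[v cv].
      rewrite /fail_near (bigD1 c)//= (bigD1 v)//= cv -addrA lerDl.
      by rewrite addr_ge0 ?sumr_ge0// => c' _; rewrite sumr_ge0.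
    by have := fail_draws_ge0 y; have := fail_poor_ge0 y; rewrite /H; lra.
  have [rich|poor] := boolP (many_rich k L (vars y)); last first.
    apply: le_trans (F_ge0 y); rewrite lee_fin subr_le0.
    have := poor_weight_ge1 L_gt0 poor; rewrite -/(fail_poor y).
    by have := fail_draws_ge0 y; have := fail_near_ge0 y; rewrite /H; lra.
  have far c v : ~~ near_pt r0 (clause y c) (vars y v).
    apply/negP => cv; move/negP: nnr; apply; apply/existsP; exists c.
    by apply/existsP; exists v.
  have c01 c : in_unit (clause y c) by apply: y01'; rewrite ltn_add2l.
  have v01 v : in_unit (vars y v) by apply: y01'; rewrite ltn_addr.
  apply: (@le_trans _ _ (1 - fail_draws y)%:E).
    rewrite lee_fin lerB// /H -addrA lerDl.
    by have := fail_poor_ge0 y; have := fail_near_ge0 y; lra.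
  rewrite lee_fin /fail_draws rich mul1r.
  apply: (@chernoff_lower R _ _
    (fun c s => draw_prob (fun v => connw p T (w v) (clause y c) (vars y v)) s)
    (fun c s => nice (fun v => connw p T (w v) (clause y c) (vars y v)) s)
    (fun c => good k L bet rho (clause y c) (vars y))) => [c s|c|c gc].
  + by apply: draw_prob_ge0 => v; exact: X_ge0.
  + have X_gt0 := connw_gt0 T p_ok r0_gt0 w_ge1 (c01 c) v01 (far c).
    exact: (sum_draw_prob X_gt0 k_le_n).
  + apply: (le_trans gam_le).
    exact: (good_nice d_gt0 L_gt0 p_ok T_gt0 B_gt0 r0_gt0 w_ge1 rho_ge0 rhoE
      (c01 c) v01 (far c) gc bet_le).
rewrite /H EX_add//; [|exact: measurable_funD|by move=> y; rewrite addr_ge0].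
rewrite EX_add// 2!EFinD; apply: leeD; last exact: EX_fail_near_le.
by apply: leeD.
Qed.

End LowerBound.

(** * Numerical estimates and the choice of constants *)

Lemma sum_geometric_le (R : realType) (q : R) n : 0 <= q -> q < 1 ->
  \sum_(j < n) q ^+ j <= (1 - q)^-1.
Proof.
move=> q0 q1; have q1' : 0 < 1 - q by rewrite subr_gt0.
rewrite -[leRHS]mul1r ler_pdivlMr//.
have := subrX1 q n; rewrite -[_ - 1]opprB -[q - 1]opprB mulNr => /oppr_inj h.
by rewrite mulrC -h gerBl exprn_ge0.
Qed.

Lemma expR_neg_le_inv (R : realType) (x y : R) : 0 < x -> x <= y -> expR (- y) <= x^-1.
Proof.
move=> x0 xy; rewrite expRN lef_pV2 ?posrE ?expR_gt0//.
by apply: le_trans (expR_ge1Dx y); lra.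
Qed.

(** A Bernoulli-type induction: [1 + k / 9] grows by a factor of at most [10 / 9] at each step. *)
Lemma nine_tenths_exp_le (R : realType) n : (0 < n)%N -> (9 / 10) ^+ n <= 9 / n%:R :> R.
Proof.
move=> n0; have n0' : 0 < n%:R :> R by rewrite ltr0n.
have aux k : (1 + k%:R / 9) * (9 / 10) ^+ k <= 1 :> R.
  elim: k => [|k IH]; first by rewrite mul0r addr0 mul1r expr0.
  apply: le_trans IH; rewrite exprS mulrA ler_wpM2r ?exprn_ge0//.
  by have : 0 <= k%:R :> R by []; rewrite -natr1; lra.
have := aux n; set E := (9 / 10) ^+ n => h.
have E0 : 0 <= E by rewrite exprn_ge0//; lra.
rewrite ler_pdivlMr//; move: h; rewrite mulrDl mul1r mulrAC; nra.
Qed.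

(** Since [9 / 10 = 6 / 5 * (3 / 4)], it suffices that [2 <= (6 / 5) ^ 4]. *)
Lemma two_exp_three_quarters_le (R : realType) (g n : nat) : (4 * g <= n)%N ->
  2 ^+ g * (3 / 4) ^+ n <= (9 / 10) ^+ n :> R.
Proof.
move=> gn.
have -> : (9 / 10) ^+ n = (6 / 5) ^+ n * (3 / 4) ^+ n :> R.
  by rewrite -exprMn; congr (_ ^+ _); lra.
rewrite ler_wpM2r ?exprn_ge0//.
apply: (@le_trans _ _ ((6 / 5) ^+ (4 * g))).
  by rewrite exprM; apply: lerXn2r; rewrite ?nnegrE//; rewrite ?exprS ?expr0; lra.
by apply: ler_weXn2l => //; lra.
Qed.

Theorem mainTheorem11 (R : realType) (d k : nat) (p : pnorm) (T eps c1 c2 CW Cw : R) :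
  (0 < d)%N -> (0 < k)%N -> pnorm_ok p ->
  0 < T -> T < 1 -> 0 < eps -> 0 < c1 ->
  exists delta : R, exists C : R, exists N : nat,
    0 < delta /\
    forall (n m : nat) (w : 'I_n -> R),
      (N <= n)%N ->
      c1 * n%:R <= m%:R -> m%:R <= c2 * n%:R ->
      (forall v, 1 <= w v) -> (exists v, w v = 1) ->
      \sum_(v < n) w v <= CW * n%:R ->
      (forall v, w v <= Cw * (n%:R `^ (1 - eps))) ->
      ((1 - C / n%:R)%:E <= prob_nice_ge d k p T n m w (delta * m%:R))%E.
Proof.
move=> d0 k0 p_ok T0 T1 _ c10.
pose al := T^-1; pose bet := (2^-1 : R) `^ al.
have al0 : 0 < al by rewrite invr_gt0.
have bet0 : 0 <= bet by exact: powR_ge0.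
have bet2 : bet < 2^-1 by apply: half_powR_lt; rewrite invf_gt1.
have q1 : 0 < 1 - 2 * bet by lra.
(* [CW] is an arbitrary real; the maximum makes the constant positive. *)
pose CW1 := Num.max CW 1.
have CW10 : 0 < CW1 by rewrite lt_max ltr01 orbT.
have dR0 : 0 < d%:R :> R by rewrite ltr0n.
have six0 : 0 < 6 ^+ d :> R by rewrite exprn_gt0.
(* With [B = b * n] the bound on the expected load, [2 * 6 ^ d * CW1 * n / (B * (1 - 2 * bet))],
   equals exactly 1/4. *)
pose b := 8 * 6 ^+ d * CW1 / (1 - 2 * bet).
have b0 : 0 < b by rewrite !(mulr_gt0, invr_gt0).
(* [K * L ^ d <= n] then says [4 * (k.+1 * L ^ d) <= n], which is what [two_exp_three_quarters_le]
   asks for. *)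
pose K := (4 * k.+1)%N.
(* A lower bound for [(d / L) ^- d / B] independent of [n], as [n <= K * 2 ^ d * L ^ d]. *)
pose z := ((K * 2 ^ d)%:R * b * d%:R ^+ d)^-1 : R.
have KR0 : 0 < (K * 2 ^ d)%:R :> R by rewrite ltr0n muln_gt0 expn_gt0.
have z0 : 0 < z by rewrite invr_gt0; apply: mulr_gt0; [exact: mulr_gt0|exact: exprn_gt0].
pose gam := Num.min 1 ((z `^ al / 2) ^+ k).
have gam0 : 0 < gam.
  by rewrite lt_min ltr01 exprn_gt0// divr_gt0// powR_gt0.
(* The three summands of [C] pay for the three failure terms: draws, poor cells and near
   collisions. *)
exists (gam / 16), (16 / (gam * c1) + 9 + 6 ^+ d * c2), K.
split; first by rewrite divr_gt0.
move=> n m w Kn c1m mc2 w1 _ Ww _.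
have K0 : (0 < K)%N by [].
have [L [L0 KLn nKL]] := max_grid d0 K0 Kn.
have n0 : (0 < n)%N by exact: leq_trans K0 Kn.
have nR0 : 0 < n%:R :> R by rewrite ltr0n.
have LR0 : 0 < L%:R :> R by rewrite ltr0n.
have kn : (k <= n)%N.
  by apply: leq_trans Kn; rewrite /K mulnS; apply: leq_trans (leq_addl _ _); rewrite leq_pmull.
pose B := b * n%:R.
have B0 : 0 < B by rewrite mulr_gt0.
pose rho (v : 'I_n) j := (w v * 2 ^+ j.+1 / B) `^ d%:R^-1.
have rho0 v j : 0 <= rho v j by exact: powR_ge0.
have rhoE v j : rho v j ^+ d = w v * 2 ^+ j.+1 / B.
  rewrite -powR_mulrn ?powR_ge0// -powRrM mulVf ?gt_eqF// powRr1//.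
  by rewrite divr_ge0 ?(ltW B0)// mulr_ge0 ?exprn_ge0// (le_trans ler01).
have load_small : \sum_(v < n) \sum_(j < n) bet ^+ j * (6 * rho v j) ^+ d <= 4^-1.
  have -> : \sum_(v < n) \sum_(j < n) bet ^+ j * (6 * rho v j) ^+ d =
      (2 * 6 ^+ d / B) * (\sum_(v < n) w v * \sum_(j < n) (2 * bet) ^+ j).
    rewrite mulr_sumr; apply: eq_bigr => v _; rewrite mulrA mulr_sumr.
    by apply: eq_bigr => j _; rewrite !exprMn rhoE exprS; ring.
  rewrite -mulr_suml.
  have hw : \sum_(v < n) w v <= CW1 * n%:R.
    by apply: (le_trans Ww); rewrite ler_pM2r// /CW1 le_max lexx.
  have hq : \sum_(j < n) (2 * bet) ^+ j <= (1 - 2 * bet)^-1.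
    by apply: sum_geometric_le; lra.
  apply: (@le_trans _ _ (2 * 6 ^+ d / B * (CW1 * n%:R * (1 - 2 * bet)^-1))).
    have cB : 0 < 2 * 6 ^+ d / B by apply: divr_gt0 => //; exact: mulr_gt0.
    rewrite ler_pM2l//; apply: ler_pM => //.
      by apply: sumr_ge0 => v _; rewrite (le_trans ler01).
    by apply: sumr_ge0 => j _; rewrite exprn_ge0//; lra.
  rewrite /B /b le_eqVlt; apply/orP; left; apply/eqP; field.
  by rewrite !gt_eqF.
have gam_le : gam <= (((d%:R / L%:R) ^- d) `^ al / (B `^ al * 2)) ^+ k.
  apply: (@le_trans _ _ ((z `^ al / 2) ^+ k)); first by rewrite ge_min lexx orbT.
  have dL0 : 0 < (d%:R / L%:R) ^- d :> R by rewrite invr_gt0 exprn_gt0// divr_gt0.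
  apply: lerXn2r; rewrite ?nnegrE ?divr_ge0 ?mulr_ge0 ?powR_ge0//.
  rewrite invfM mulrA ler_pM2r ?invr_gt0//.
  have -> : (B `^ al)^-1 = (B^-1) `^ al.
    by rewrite -(powR_inv1 (ltW B0)) powRAC powR_inv1// powR_ge0.
  rewrite -powRM ?invr_ge0 ?(ltW B0)//.
  apply: ge0_ler_powR; rewrite ?nnegrE ?(ltW al0) ?(ltW z0)//.
    by rewrite mulr_ge0 ?invr_ge0 ?(ltW B0)// ltW// -invr_gt0.
  have Z0 : 0 < (K * 2 ^ d)%:R * b * d%:R ^+ d by rewrite -invr_gt0.
  have Ld0 : 0 < L%:R ^+ d :> R by exact: exprn_gt0.
  rewrite /z -invfM lef_pV2 ?posrE//; last by rewrite mulr_gt0// -invr_gt0.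
  have -> : (d%:R / L%:R) ^+ d * B = b * d%:R ^+ d * (n%:R / L%:R ^+ d).
    by rewrite expr_div_n /B; field; rewrite gt_eqF.
  have -> : (K * 2 ^ d)%:R * b * d%:R ^+ d = b * d%:R ^+ d * (K * 2 ^ d)%:R by ring.
  have bd0 : 0 < b * d%:R ^+ d by apply: mulr_gt0 => //; exact: exprn_gt0.
  rewrite ler_pM2l//.
  by rewrite ler_pdivrMr// -natrX -natrM ler_nat.
(* There are at most [c2 * n ^ 2] clause-variable pairs, so a collision probability of order
   [n ^- 3] for each leaves a total of order [1 / n]. *)
pose r0 : R := n%:R ^- 3.
have r00 : 0 < r0 by rewrite invr_gt0 exprn_gt0.
have gam01 : 0 <= gam <= 1 by rewrite (ltW gam0) ge_min lexx.
apply: le_trans (prob_nice_ge_lower m d0 L0 kn p_ok T0 T1 B0 r00 w1 rho0 rhoE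
  load_small gam01 gam_le).
rewrite lee_fin lerB// 2!(mulrDl _ _ n%:R^-1); apply: lerD; first apply: lerD.
- have g16 : 0 < gam / 16 by rewrite divr_gt0.
  have -> : 16 / (gam * c1) / n%:R = (gam / 16 * (c1 * n%:R))^-1.
    by field; rewrite !gt_eqF.
  rewrite mulNr; apply: expR_neg_le_inv; last by rewrite ler_pM2l.
  by apply: mulr_gt0 => //; exact: mulr_gt0.
- apply: le_trans (nine_tenths_exp_le R n0); apply: two_exp_three_quarters_le.
  by apply: leq_trans KLn; rewrite /K mulnA.
- have r0d : r0 ^+ d <= r0.
    apply: ler_iXnr => //; first exact: ltW.
    by rewrite /r0 invf_le1 ?exprn_gt0// exprn_ege1// ler1n.
  apply: (@le_trans _ _ (n%:R * (c2 * n%:R) * (6 ^+ d * r0))).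
    rewrite exprMn; apply: ler_pM; rewrite ?mulr_ge0 ?exprn_ge0 ?(ltW r00)//.
      by rewrite ler_pM2l.
    by rewrite ler_pM2l.
  rewrite /r0 le_eqVlt; apply/orP; left; apply/eqP; field.
  by rewrite gt_eqF.
Qed.
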